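(* Let $\lambda$ be a partition of length at most $nt$. Then $\varphi_t\mathrm{so}_\lambda=0$ unless $t\text{-core}(\lambda)$ is self-conjugate, in which case \[ \varphi_t\mathrm{so}_\lambda= (-1)^{\varepsilon^{\mathrm{so}}_{\lambda;nt}} \operatorname{sgn}(w_t(\lambda;nt)) \prod_{r=0}^{\lfloor(t-2)/2\rfloor}\mathrm{rs}_{\lambda^{(r)},\lambda^{(t-r-1)}} \times\begin{cases} 1 & \text{$t$ even},\\ \mathrm{so}_{\lambda^{((t-1)/2)}} & \text{$t$ odd}, \end{cases} \] where \[ \varepsilon^{\mathrm{so}}_{\lambda;nt}= \sum_{r=\lfloor (t+1)/2\rfloor}^{t-1}\binom{m_r(\lambda;nt)+1}{2}+ \begin{cases} 0 & \text{$t$ even}, \\ n\,\mathrm{rk}(t\text{-core}(\lambda)) & \text{$t$ odd}. \end{cases} \]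
   Context: Let $t\geq 2$ and $n$ be integers. $\Lambda$ is the ring of symmetric functions, with complete homogeneous symmetric functions $h_r$ ($h_0=1$, $h_r=0$ for $r<0$). The operator $\varphi_t:\Lambda\to\Lambda$ is the ring homomorphism with $\varphi_t h_r=h_{r/t}$ if $t\mid r$ and $\varphi_t h_r=0$ otherwise. For a partition $\lambda$ with $l(\lambda)\leq N$: $\mathrm{so}_\lambda:=\det_{1\leq i,j\leq N}(h_{\lambda_i-i+j}+h_{\lambda_i-i-j+1})$, and for partitions $\lambda,\mu$ with $l(\lambda)\le N$, $l(\mu)\le M$, $\mathrm{rs}_{\lambda,\mu}$ is the $(N+M)\times(N+M)$ block determinant with blocks $(h_{\lambda_i-i+j})_{1\le i,j\le N}$, $(h_{\lambda_i-i-j+1})_{1\le i\le N,1\le j\le M}$, $(h_{\mu_i-i-j+1})_{1\le i\le M,1\le j\le N}$, $(h_{\mu_i-i+j})_{1\le i,j\le M}$ (equivalently $\mathrm{rs}_{\lambda,\mu}=\sum_\nu(-1)^{|\nu|}s_{\lambda/\nu}s_{\mu/\nu'}$). The beta set is $\beta(\lambda;nt)=\{\lambda_i+nt-i:1\le i\le nt\}$; $m_r(\lambda;nt)$ is the number of its elements congruent to $r$ mod $t$; writing those elements as $\xi^{(r)}_k t+r$ with $\xi^{(r)}_1>\cdots>\xi^{(r)}_{m_r}\ge0$, the $t$-quotient $(\lambda^{(0)},\dots,\lambda^{(t-1)})$ is given by $\lambda^{(r)}_k=\xi^{(r)}_k-m_r(\lambda;nt)+k$ (always computed with a number of beads that is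 a multiple of $t$). $t\text{-core}(\lambda)$ is the partition obtained by removing $t$-ribbons from $\lambda$ until no longer possible. $w_t(\lambda;nt)$ is the permutation of $\beta(\lambda;nt)$ sorting the elements so that residues mod $t$ increase and elements within each residue class decrease; $\operatorname{sgn}$ is its sign. $\mathrm{rk}(\mu)$ is the Frobenius rank (side of the Durfee square) of $\mu$. *)

(* Defs.v *)
From HB Require Import structures.
From mathcomp Require Import all_boot all_order all_fingroup all_algebra.
From mathcomp Require Import boolp.
From mathcomp Require Import mpoly zify.

Set Implicit Arguments.
Unset Strict Implicit.
Unset Printing Implicit Defensive.

Import GRing.Theory.
Local Open Scope ring_scope.

(* The ring Lambda of symmetric functions over the integers, as the graded
   inverse limit of the rings of symmetric polynomials (Macdonald, I.2): an
   element is a family (f_N) of symmetric polynomials f_N(x_1, ..., x_N), of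
   bounded degree, with f_{N+1}(x_1, ..., x_N, 0) = f_N(x_1, ..., x_N). *)

Definition polyfam := forall N : nat, {mpoly int[N]}.

HB.instance Definition _ := gen_eqMixin polyfam.
HB.instance Definition _ := gen_choiceMixin polyfam.

Section PolyfamRing.
Implicit Types f g k : polyfam.

Let add f g : polyfam := fun N => f N + g N.
Let opp f : polyfam := fun N => - f N.
Let mul f g : polyfam := fun N => f N * g N.

Fact polyfam_addA : associative add.
Proof. by move=> f g k; apply: functional_extensionality_dep => N; exact: addrA. Qed.
Fact polyfam_addC : commutative add.
Proof. by move=> f g; apply: functional_extensionality_dep => N; exact: addrC. Qed.
Fact polyfam_add0 : left_id (fun=> 0) add.
Proof. by move=> f; apply: functional_extensionality_dep => N; exact: add0r. Qed.
Fact polyfam_addN : left_inverse (fun=> 0) opp add.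
Proof. by move=> f; apply: functional_extensionality_dep => N; exact: addNr. Qed.

HB.instance Definition _ := GRing.isZmodule.Build polyfam
  polyfam_addA polyfam_addC polyfam_add0 polyfam_addN.

Fact polyfam_mulA : associative mul.
Proof. by move=> f g k; apply: functional_extensionality_dep => N; exact: mulrA. Qed.
Fact polyfam_mulC : commutative mul.
Proof. by move=> f g; apply: functional_extensionality_dep => N; exact: mulrC. Qed.
Fact polyfam_mul1 : left_id (fun=> 1) mul.
Proof. by move=> f; apply: functional_extensionality_dep => N; exact: mul1r. Qed.
Fact polyfam_mulD : left_distributive mul +%R.
Proof. by move=> f g k; apply: functional_extensionality_dep => N; exact: mulrDl. Qed.
Fact polyfam_1neq0 : (fun=> 1) != 0 :> polyfam.
Proof.
apply/eqP => /(congr1 (fun f : polyfam => f 0%N)) /eqP.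
by rewrite (negPf (oner_neq0 _)).
Qed.

HB.instance Definition _ := GRing.Zmodule_isComNzRing.Build polyfam
  polyfam_mulA polyfam_mulC polyfam_mul1 polyfam_mulD polyfam_1neq0.

End PolyfamRing.

Definition set_last0 (N : nat) (p : {mpoly int[N.+1]}) : {mpoly int[N]} :=
  p \mPo [tuple if unlift ord_max i is Some j then 'X_j else 0 | i < N.+1].

Definition symfun_axiom (f : polyfam) : Prop :=
  [/\ forall N, f N \is symmetric,
      forall N, set_last0 (f N.+1) = f N
    & exists d : nat, forall N, (msize (f N) <= d)%N].

Definition symfun_pred : {pred polyfam} := fun f => `[< symfun_axiom f >].

Fact symfun_subring : subring_closed symfun_pred.
Proof.
split=> [|f g /asboolP[fs fr [d fd]] /asboolP[gs gr [e ge]]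
         |f g /asboolP[fs fr [d fd]] /asboolP[gs gr [e ge]]].
- apply/asboolP; split=> [N|N|]; first exact: rpred1.
    exact: comp_mpoly1.
  by exists 1%N => N; rewrite msize1.
- apply/asboolP; split=> [N|N|]; first exact: (rpredB (fs N) (gs N)).
    rewrite [RHS](_ : _ = f N - g N) // -(fr N) -(gr N).
    exact: comp_mpolyB.
  exists (maxn d e) => N; apply: leq_trans (msizeD_le _ _) _.
  by rewrite msizeN geq_max !leq_max fd ge orbT.
- apply/asboolP; split=> [N|N|]; first exact: (rpredM (fs N) (gs N)).
    rewrite [RHS](_ : _ = f N * g N) // -(fr N) -(gr N).
    exact: rmorphM.
  exists (d + e)%N => N; have [f0|f0] := eqVneq (f N) 0.
    by rewrite [X in msize X](_ : _ = 0) ?msize0 // -(mul0r (g N)) -f0.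
  have [g0|g0] := eqVneq (g N) 0.
    by rewrite [X in msize X](_ : _ = 0) ?msize0 // -(mulr0 (f N)) -g0.
  rewrite [X in msize X](_ : _ = f N * g N) // msizeM //.
  by rewrite (leq_trans (leq_pred _)) // leq_add.
Qed.

HB.instance Definition _ :=
  GRing.isSubringClosed.Build polyfam symfun_pred symfun_subring.

Record symfun := SymFun {symfun_val :> polyfam; _ : symfun_val \in symfun_pred}.

HB.instance Definition _ := [isSub for symfun_val].
HB.instance Definition _ := [Choice of symfun by <:].
HB.instance Definition _ := [SubChoice_isSubComNzRing of symfun by <:].

Definition hfam (r : nat) : polyfam :=
  fun N => \sum_(m : 'X_{1..N < r.+1} | mdeg m == r) 'X_[m].

Lemma mcoeff_hfam (r N : nat) (m : 'X_{1..N}) :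
  (hfam r N)@_m = (mdeg m == r)%:R.
Proof.
rewrite raddf_sum /=.
under eq_bigr do rewrite mcoeffX.
have [mr|mr] := eqVneq (mdeg m) r; last first.
  rewrite big1 // => k /eqP kr; case: eqP => // km.
  by rewrite -km kr eqxx in mr.
have mlt : (mdeg m < r.+1)%N by rewrite mr.
rewrite (bigD1 (BMultinom mlt)) /= ?mr // eqxx big1 ?addr0 // => k /andP[_ kn].
by case: eqP => // km; case/eqP: kn; apply/val_inj.
Qed.

Fact mcoeff_set_last0X (N : nat) (k : 'X_{1..N.+1}) (m : 'X_{1..N}) :
  (set_last0 'X_[k])@_m = (k == mnmwiden m)%:R.
Proof.
rewrite /set_last0 comp_mpolyX big_ord_recr /= tnth_mktuple unlift_none.
pose k' := [multinom k (widen_ord (leqnSn N) i) | i < N].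
rewrite (eq_bigr (fun i : 'I_N => 'X_i ^+ (k' i))); last first.
  move=> i _; rewrite tnth_mktuple mnmE.
  have -> : widen_ord (leqnSn N) i = lift ord_max i.
    by apply/val_inj; rewrite /= /bump leqNgt ltn_ord.
  by rewrite liftK.
rewrite -mpolyXE_id; have [k0|k0] := eqVneq (k ord_max) 0%N.
  rewrite k0 expr0 mulr1 mcoeffX; congr (_%:R); congr nat_of_bool.
  apply/eqP/eqP => [<-|km]; apply/mnmP => i; last first.
    by rewrite mnmE km mnmwiden_widen.
  case: (unliftP ord_max i) => [j ->|->]; last by rewrite mnmwiden_ordmax.
  have -> : lift ord_max j = widen_ord (leqnSn N) j.
    by apply/val_inj; rewrite /= /bump leqNgt ltn_ord.
  by rewrite mnmwiden_widen mnmE.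
rewrite expr0n (negPf k0) mulr0 mcoeff0.
by case: eqP => // km; rewrite km mnmwiden_ordmax in k0.
Qed.

Fact mdeg_mnmwiden (N : nat) (m : 'X_{1..N}) : mdeg (mnmwiden m) = mdeg m.
Proof.
rewrite !mdegE big_ord_recr /= mnmwiden_ordmax addn0.
by apply: eq_bigr => i _; rewrite mnmwiden_widen.
Qed.

Fact set_last0_hfam (r N : nat) : set_last0 (hfam r N.+1) = hfam r N.
Proof.
apply/mpolyP => m; rewrite mcoeff_hfam -mdeg_mnmwiden -mcoeff_hfam.
rewrite /set_last0 /hfam (raddf_sum (comp_mpoly _)) !(raddf_sum (mcoeff _)).
apply: eq_bigr => k _; apply: etrans (mcoeff_set_last0X _ _) _.
by rewrite /= mcoeffX.
Qed.

Fact hfam_symfun (r : nat) : hfam r \in symfun_pred.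
Proof.
apply/asboolP; split=> [N|N|].
- apply/issymP => s; apply/mpolyP => m.
  by rewrite mcoeff_sym !mcoeff_hfam mdeg_mperm.
- exact: set_last0_hfam.
- exists r.+1 => N; apply: leq_trans (msize_sum _ _ _) _.
  apply/bigmax_leqP_seq => m _ /eqP mr; rewrite mmeasureX.
  by apply: eq_leq; congr _.+1; exact: mr.
Qed.


Definition h (r : nat) : symfun := SymFun (hfam_symfun r).

Definition hz (r : int) : symfun := if r is Posz k then h k else 0.

(* h_1, h_2, ... are algebraically independent generators of Lambda, so there
   is exactly one such ring homomorphism; it is phi_t. *)
Definition is_varphi (t : nat) (phi : {rmorphism symfun -> symfun}) : Prop :=
  forall r : nat, phi (h r) = if (t %| r)%N then h (r %/ t) else 0.

(* A partition is the weakly decreasing list of its nonzero parts.  All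
   matrix and list indices start at 0, so lambda_i is [nth 0 lam (i - 1)]. *)

Definition is_partition (lam : seq nat) : bool :=
  sorted geq lam && (0%N \notin lam).

Definition part (lam : seq nat) (i : nat) : int := (nth 0%N lam i)%:Z.

Definition so_det (N : nat) (lam : seq nat) : symfun :=
  \det (\matrix_(i < N, j < N)
    (hz (part lam i - i%:Z + j%:Z) + hz (part lam i - i%:Z - j%:Z - 1))).

Definition rs_det (N M : nat) (lam mu : seq nat) : symfun :=
  \det (block_mx
    (\matrix_(i < N, j < N) hz (part lam i - i%:Z + j%:Z))
    (\matrix_(i < N, j < M) hz (part lam i - i%:Z - j%:Z - 1))
    (\matrix_(i < M, j < N) hz (part mu i - i%:Z - j%:Z - 1))
    (\matrix_(i < M, j < M) hz (part mu i - i%:Z + j%:Z))).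

(* The determinants do not depend on the number of rows, once it is at least
   the number of parts: see [so_detE] and [rs_detE]. *)
Definition so (lam : seq nat) : symfun := so_det (size lam) lam.

Definition rs (lam mu : seq nat) : symfun := rs_det (size lam) (size mu) lam mu.

Lemma det_unit_row (R : comNzRingType) (K r : nat) (E : nat -> nat -> R) :
  (r <= K)%N -> (forall j, (j <= K)%N -> E r j = (j == r)%:R) ->
  \det (\matrix_(i < K.+1, j < K.+1) E i j)
  = \det (\matrix_(i < K, j < K) E (bump r i) (bump r j)).
Proof.
move=> rK Er; have rK1 : (r < K.+1)%N by [].
rewrite (expand_det_row _ (Ordinal rK1)) (bigD1 (Ordinal rK1)) //= big1.
  rewrite addr0 mxE Er // eqxx mul1r /cofactor -signr_odd addnn odd_double.
  by rewrite expr0 mul1r; congr (\det _); apply/matrixP => i j; rewrite !mxE.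
move=> j jr; rewrite mxE /= Er; last by rewrite -ltnS.
by rewrite -val_eqE /= in jr; rewrite (negPf jr) mul0r.
Qed.

Lemma hz_neg (a : int) : (a < 0)%R -> hz a = 0.
Proof. by case: a. Qed.

Lemma h0 : h 0 = 1.
Proof.
apply/val_inj/functional_extensionality_dep => N; apply/mpolyP => m.
by rewrite mcoeff_hfam mcoeff1 mdeg_eq0.
Qed.

Lemma so_detE (N : nat) (lam : seq nat) :
  (size lam <= N)%N -> so_det N lam = so lam.
Proof.
move=> /subnK <-; elim: (N - _)%N => // d; rewrite addSn => <-.
set K := (d + size lam)%N.
pose E i j := hz (part lam i - i%:Z + j%:Z) + hz (part lam i - i%:Z - j%:Z - 1).
rewrite [LHS](@det_unit_row _ K K E) // => [|j jK].
  congr (\det _); apply/matrixP => i j; rewrite !mxE /bump.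
  by rewrite !(leqNgt K) !ltn_ord.
rewrite /E /part nth_default ?leq_addl // sub0r.
rewrite [X in _ + X]hz_neg ?addr0; last by lia.
have [->|jnK] := eqVneq j K; first by rewrite addNr [hz _]h0.
by rewrite hz_neg //; lia.
Qed.

Definition rs_entry (lam mu : seq nat) (N i j : nat) : symfun :=
  if (i < N)%N then
    if (j < N)%N then hz (part lam i - i%:Z + j%:Z)
    else hz (part lam i - i%:Z - (j - N)%N%:Z - 1)
  else
    if (j < N)%N then hz (part mu (i - N) - (i - N)%N%:Z - j%:Z - 1)
    else hz (part mu (i - N) - (i - N)%N%:Z + (j - N)%N%:Z).

Lemma rs_det_entry (N M : nat) (lam mu : seq nat) :
  rs_det N M lam mu
  = \det (\matrix_(i < N + M, j < N + M) rs_entry lam mu N i j).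
Proof.
congr (\det _); apply/matrixP => i j; rewrite !mxE /rs_entry.
by case: splitP => i' ->; rewrite mxE; case: splitP => j' ->; rewrite mxE;
   rewrite ?ltn_ord ?(ltnNge (N + _)) ?leq_addr ?addKn.
Qed.

Lemma rs_detE (N M : nat) (lam mu : seq nat) :
  (size lam <= N)%N -> (size mu <= M)%N -> rs_det N M lam mu = rs lam mu.
Proof.
move=> /subnK <- /subnK <-.
elim: (M - _)%N => [|d IH]; last first.
  rewrite -{}IH !rs_det_entry addSn addnS.
  set N' := (_ + size lam)%N; set M' := (d + size mu)%N.
  rewrite (@det_unit_row _ (N' + M') (N' + M') (rs_entry lam mu N')) // => [|j jK].
    congr (\det _); apply/matrixP => i j; rewrite !mxE /bump.
    by rewrite !(leqNgt (N' + M')) !ltn_ord.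
  rewrite /rs_entry ltnNge leq_addr addKn /part (@nth_default _ _ mu) ?leq_addl //=.
  case: ltnP => jN.
    by rewrite ltn_eqF ?(leq_trans jN) ?leq_addr // hz_neg //; lia.
  have [->|jnK] := eqVneq j (N' + M')%N; first by rewrite addKn sub0r addNr [hz _]h0.
  by rewrite hz_neg //; lia.
elim: (N - _)%N => // d IH; rewrite -{}IH !rs_det_entry add0n addSn.
set N' := (d + size lam)%N; set M' := size mu.
rewrite (@det_unit_row _ (N' + M') N' (rs_entry lam mu N'.+1)) ?leq_addr //.
  congr (\det _); apply/matrixP => i j; rewrite !mxE /rs_entry /bump.
  case: (leqP N' i) => iN; case: (leqP N' j) => jN /=;
  rewrite ?add1n ?add0n ?ltnS ?subSS ?(ltnNge i) ?(ltnNge j) ?jN ?iN //=;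
  by rewrite ?(ltnW iN) ?(ltnW jN).
move=> j jK; rewrite /rs_entry ltnSn /part nth_default ?leq_addl // ltnS.
case: leqP => jN.
  have [->|jnN] := eqVneq j N'; first by rewrite sub0r addNr [hz _]h0.
  by rewrite hz_neg //; lia.
by rewrite gtn_eqF // hz_neg //; lia.
Qed.

Definition conj_part (lam : seq nat) : seq nat :=
  [seq count (fun x => i < x)%N lam | i <- iota 0 (head 0%N lam)].

(* The Frobenius rank: the largest d such that the d x d square fits in the
   Young diagram. *)
Definition rk (lam : seq nat) : nat :=
  (\max_(d < (size lam).+1 | [forall i : 'I_d, d <= nth 0 lam i]) d)%N.

Definition in_diagram (lam : seq nat) (c : nat * nat) : bool :=
  (c.2 < nth 0 lam c.1)%N.

Definition in_skew (lam mu : seq nat) (c : nat * nat) : bool :=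
  in_diagram lam c && ~~ in_diagram mu c.

Definition adjacent (c d : nat * nat) : bool :=
     ((c.1 == d.1) && ((c.2 == d.2.+1) || (d.2 == c.2.+1)))
  || ((c.2 == d.2) && ((c.1 == d.1.+1) || (d.1 == c.1.+1))).

(* mu is obtained from lam by removing a t-ribbon: lam/mu is a connected skew
   shape with t cells which contains no 2 x 2 square. *)
Definition remove_ribbon (t : nat) (lam mu : seq nat) : Prop :=
  [/\ is_partition mu /\ (forall c, in_diagram mu c -> in_diagram lam c),
      sumn lam = (sumn mu + t)%N,
      forall c d, in_skew lam mu c -> in_skew lam mu d ->
        exists p, [/\ path adjacent c p, all (in_skew lam mu) p & last c p = d]
    & forall i j, ~~ [&& in_skew lam mu (i, j), in_skew lam mu (i, j.+1),
                         in_skew lam mu (i.+1, j) & in_skew lam mu (i.+1, j.+1)]].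

Inductive remove_ribbons (t : nat) (lam : seq nat) : seq nat -> Prop :=
| remove_ribbons0 : remove_ribbons t lam lam
| remove_ribbonsS mu nu : remove_ribbons t lam mu -> remove_ribbon t mu nu ->
    remove_ribbons t lam nu.

Definition is_tcore (t : nat) (lam core : seq nat) : Prop :=
  remove_ribbons t lam core /\ forall mu, ~ remove_ribbon t core mu.

Lemma is_tcore_exists (t : nat) (lam : seq nat) :
  (0 < t)%N -> exists core, is_tcore t lam core.
Proof.
move=> t0; suff: forall k mu, (sumn mu <= k)%N -> remove_ribbons t lam mu ->
    exists core, is_tcore t lam core.
  by move=> /(_ _ lam (leqnn _)); apply; exact: remove_ribbons0.
elim=> [|k IH] mu muk rmu.
  exists mu; split=> // nu [_ e _ _]; move: muk; rewrite e leqn0 addn_eq0.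
  by rewrite (gtn_eqF t0) andbF.
have [[nu rnu]|no] := pselect (exists nu, remove_ribbon t mu nu); last first.
  by exists mu; split=> // nu rnu; apply: no; exists nu.
apply: (IH nu); last exact: remove_ribbonsS rmu rnu.
by case: rnu => _ e _ _; lia.
Qed.

(* In decreasing order when [lam] is a partition with at most [N] parts. *)
Definition beta (lam : seq nat) (N : nat) : seq nat :=
  [seq (nth 0 lam i + N - i.+1)%N | i <- iota 0 N].

Definition mres (t : nat) (lam : seq nat) (N r : nat) : nat :=
  count (fun x => x %% t == r)%N (beta lam N).

Definition xires (t : nat) (lam : seq nat) (N r : nat) : seq nat :=
  [seq (x %/ t)%N | x <- beta lam N & (x %% t == r)%N].

(* The subtraction is never truncated, since xi_k >= m_r - k.  The zero parts
   are dropped. *)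
Definition tquotient (t : nat) (lam : seq nat) (N r : nat) : seq nat :=
  [seq x <- [seq (nth 0 (xires t lam N r) k + k.+1 - mres t lam N r)%N
            | k <- iota 0 (mres t lam N r)] | x != 0%N].

Definition residue_le (t : nat) : rel nat := fun x y =>
  ((x %% t < y %% t) || ((x %% t == y %% t) && (y <= x)))%N.

(* The permutation p of the positions such that the i-th element of the sorted
   beta set is the p(i)-th element of the beta set; it exists by [wpermP], and
   it is unique as soon as the elements of the beta set are distinct. *)
Definition wperm (t : nat) (lam : seq nat) (N : nat) : 'S_N :=
  odflt 1%g [pick p : 'S_N | sort (residue_le t) (beta lam N)
                          == [seq nth 0%N (beta lam N) (p i) | i <- enum 'I_N]].

Lemma wpermP (t : nat) (lam : seq nat) (N : nat) :
  sort (residue_le t) (beta lam N)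
  = [seq nth 0%N (beta lam N) (wperm t lam N i) | i <- enum 'I_N].
Proof.
rewrite /wperm; case: pickP => [p /eqP //|no].
have sz : size (beta lam N) == N by rewrite size_map size_iota.
have: perm_eq (sort (residue_le t) (beta lam N)) (Tuple sz) by rewrite perm_sort.
move=> /tuple_permP[p e]; case/eqP: (no p); rewrite e.
by apply: eq_map => i; rewrite (tnth_nth 0%N).
Qed.

Definition eps_so (t n : nat) (lam core : seq nat) : nat :=
  (\sum_((t.+1)./2 <= r < t) 'C((mres t lam (n * t) r).+1, 2)
   + (if odd t then n * rk core else 0))%N.

(* Main.v *)
(* Applying [phi] entrywise, the entry of [phi (so lam)] in the row of the bead
   [b] and column [j] vanishes unless [j = b] or [j = t - 1 - b] modulo [t].  So,
   for each pair of residues [r], [r' = t - 1 - r], the rows of the beads with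
   residue [r] or [r'] live on the [2 n] columns with these residues: the
   determinant is zero unless [m_r + m_r' = 2 n] for all [r], and otherwise it is,
   up to a permutation of rows and columns, block diagonal with blocks [rs] (and
   one block [so] for the middle residue).  Sorting the rows costs the sign of
   [wperm].  The sign of the column permutation is an inversion parity: peeling
   off the outermost pair of residues compares it with the case where all [m_r]
   are [n], in which it is explicit.

   Removing a [t]-ribbon moves one bead from [b] to [b - t], so the [m_r] are
   those of the core, whose beads of residue [r] are [r, r + t, ...] without gap;
   its self-conjugacy is the symmetry [x <-> 2 n t - 1 - x] between beads and
   gaps, that is [m_r + m_r' = 2 n]; its rank counts the beads [>= n t]. *)

Require Import Defs.
From mathcomp Require Import all_boot all_order all_fingroup all_algebra.
From mathcomp Require Import boolp zify.

Set Implicit Arguments.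
Unset Strict Implicit.
Unset Printing Implicit Defensive.

Import Order.TTheory GRing.Theory Num.Theory.
Local Open Scope ring_scope.

Ltac odd_cases := repeat match goal with |- context [odd ?x] => case: (odd x) end.

(** * Inversions and determinants *)

Section Inversions.

Implicit Types s u : seq nat.

Fixpoint inversions (s : seq nat) : nat :=
  if s is x :: s' then (count (fun y => y < x)%N s' + inversions s')%N else 0%N.

Definition cross (s u : seq nat) : nat :=
  (\sum_(x <- s) count (fun y => y < x)%N u)%N.

Lemma inversions_cat s u : inversions (s ++ u) = (inversions s + inversions u + cross s u)%N.
Proof.
elim: s => [|x s IH] /=; first by rewrite /cross big_nil addn0.
by rewrite IH /cross big_cons count_cat; lia.
Qed.

Lemma cross_catl (s1 s2 u : seq nat) : cross (s1 ++ s2) u = (cross s1 u + cross s2 u)%N.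
Proof. by rewrite /cross big_cat. Qed.

Lemma cross_catr (s u1 u2 : seq nat) : cross s (u1 ++ u2) = (cross s u1 + cross s u2)%N.
Proof. by rewrite /cross -big_split; apply: eq_bigr => x _; rewrite count_cat. Qed.

Lemma cross_perm (s1 s2 u1 u2 : seq nat) :
  perm_eq s1 s2 -> perm_eq u1 u2 -> cross s1 u1 = cross s2 u2.
Proof.
move=> es eu; rewrite /cross (perm_big _ es); apply: eq_bigr => x _.
exact: (seq.permP eu).
Qed.

Lemma cross_consr s y u : cross s (y :: u) = (count (fun x => y < x)%N s + cross s u)%N.
Proof.
rewrite /cross; elim: s => [|x s IH]; first by rewrite !big_nil.
by rewrite !big_cons IH /=; lia.
Qed.

(** The entries are distinct, so each pair with one entry in [s] and one in [u] is counted by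
    exactly one of the two terms. *)
Lemma cross_sym s u :
  uniq (s ++ u) -> (cross s u + cross u s)%N = (size s * size u)%N.
Proof.
elim: s => [|x s IH] /=.
  by rewrite /cross big_nil add0n big1_seq // => y _; rewrite count_pred0.
rewrite mem_cat negb_or => /andP[/andP[_ xu] us]; rewrite mulSn -(IH us).
rewrite cross_consr {1}/cross big_cons -/(cross _ _).
have -> : count (fun y => x < y)%N u = (size u - count (fun y => y < x)%N u)%N.
  rewrite -(count_predC (fun y => y < x)%N u) addKn; apply: eq_in_count => y yu /=.
  have: x != y by apply: contraNneq xu => ->.
  by lia.
have := count_size (fun y => y < x)%N u; lia.
Qed.

Lemma inversions_rev s : uniq s -> (inversions (rev s) + inversions s)%N = 'C(size s, 2).
Proof.
elim: s => [|x s IH] //= /andP[xs us].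
rewrite rev_cons -cats1 inversions_cat /= binS bin1 -IH // cross_consr [cross _ [::]]big1_eq.
rewrite count_rev.
have <- : (count (fun y => y < x)%N s + count (fun y => x < y)%N s)%N = size s.
  rewrite -(count_predC (fun y => y < x)%N s); congr (_ + _)%N.
  apply: eq_in_count => y ys /=.
  have: x != y by apply: contraNneq xs => ->.
  by lia.
by lia.
Qed.

Lemma perm_cat3 (T : eqType) (a b c : seq T) :
  perm_eq (a ++ b ++ c) (a ++ c ++ b).
Proof. by rewrite perm_cat2l perm_catC. Qed.

(* Moving [b] in front and reversing it turns the word into a shuffle of
   [rev b ++ a] with [c], which contributes the same to both sides. *)
Lemma inversions_outer (a c b a0 c0 b0 : seq nat) :
  uniq (a ++ c ++ b) -> uniq (a0 ++ c0 ++ b0) -> perm_eq c c0 ->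
  rev b ++ a = rev b0 ++ a0 ->
  odd (inversions (a ++ c ++ b)) (+) odd (inversions (a0 ++ c0 ++ b0))
  = odd (inversions c) (+) odd (inversions c0)
    (+) odd ('C(size b, 2) + size a * size b + size c * size b)
    (+) odd ('C(size b0, 2) + size a0 * size b0 + size c0 * size b0).
Proof.
have step a' c' b' : uniq (a' ++ c' ++ b') ->
  odd (inversions (a' ++ c' ++ b')) = odd (inversions (rev b' ++ a')) (+) odd (inversions c')
    (+) odd (cross (rev b' ++ a') c')
    (+) odd ('C(size b', 2) + size a' * size b' + size c' * size b').
  move=> u; have rb : perm_eq (rev b') b' by rewrite perm_rev.
  rewrite !inversions_cat !cross_catr cross_catl !(cross_perm rb (perm_refl _)).
  have ub : uniq b' by move: u; rewrite !cat_uniq; case/and3P => _ _ /and3P[].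
  have uab : uniq (a' ++ b').
    by move: u; rewrite (perm_uniq (perm_cat3 _ _ _)) catA cat_uniq; case/and3P.
  have ucb : uniq (c' ++ b') by move: u; rewrite cat_uniq; case/and3P.
  have := inversions_rev ub; have := cross_sym uab; have := cross_sym ucb.
  by move=> <- <- <-; rewrite !oddD; odd_cases.
move=> u u0 cc0 e; rewrite (step _ _ _ u) (step _ _ _ u0) -e.
rewrite (cross_perm (perm_refl (rev b ++ a)) cc0).
by odd_cases.
Qed.

(** A factor is -1 exactly at an inversion. The right-hand side is the shape in which a Vandermonde
    product delivers a sign. *)
Lemma sign_inversions_prod (s : seq nat) : uniq s ->
  (-1) ^+ inversions s = \prod_(i < size s) \prod_(j < size s | (i < j)%N)
     sgz ((nth 0%N s j)%:Z - (nth 0%N s i)%:Z) :> int.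
Proof.
elim: s => [|x s IH] /=; first by rewrite big_ord0.
move=> /andP[xs us]; rewrite exprD IH // big_ord_recl /=; congr (_ * _); last first.
  apply: eq_bigr => i _; rewrite [RHS]big_mkcond big_ord_recl /= mul1r -big_mkcond /=.
  by apply: eq_bigl => j; rewrite ltnS.
rewrite [RHS]big_mkcond big_ord_recl /= mul1r.
rewrite -sum1_count (big_morph (fun k => (-1) ^+ k) (exprD (-1)) (expr0 (-1))).
rewrite big_mkcond (big_nth 0%N) big_mkord /=.
apply: eq_bigr => i _.
have: x != nth 0%N s i by apply: contraNneq xs => ->; rewrite mem_nth.
move: (nth 0%N s i) => y xy; rewrite expr1.
by case: ifP => yx; [rewrite ltr0_sgz ?subr_lt0 | rewrite gtr0_sgz ?subr_gt0];
  rewrite ?ltz_nat ?expr0 ?mulr1; lia.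
Qed.

(** Permuting the columns of the Vandermonde matrix on 0, ..., N-1 multiplies its determinant by the
    sign of [p]. Compare signs in the two product formulas: the unpermuted product is positive. *)
Lemma odd_perm_inversions (N : nat) (p : 'S_N) :
  odd (inversions [seq nat_of_ord (p i) | i <- enum 'I_N]) = p.
Proof.
set s := [seq _ | _ <- _].
have us : uniq s.
  by rewrite map_inj_uniq ?enum_uniq // => i j /val_inj /perm_inj.
have sN : size s = N by rewrite size_map size_enum_ord.
have nthp i : nth 0%N s (nat_of_ord i) = p i :> nat.
  by rewrite (nth_map i) ?size_enum_ord // nth_ord_enum.
pose a := \row_(j < N) (j%:Z : int).
have eV : Vandermonde N (col_perm p a) = col_perm p (Vandermonde N a).
  by apply/matrixP => i j; rewrite !mxE.
have := det_Vandermonde (col_perm p a).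
rewrite eV col_permE det_mulmx det_perm det_Vandermonde odd_permV.
have prodsgz (P : 'I_N -> pred 'I_N) (F : 'I_N -> 'I_N -> int) :
  sgz (\prod_(i < N) \prod_(j < N | P i j) F i j)
  = \prod_(i < N) \prod_(j < N | P i j) sgz (F i j).
  rewrite (big_morph (@sgz int) (@sgzM int) (@sgz1 int)); apply: eq_bigr => i _.
  exact: (big_morph (@sgz int) (@sgzM int) (@sgz1 int)).
move=> /(congr1 (@sgz int)); rewrite sgzM !prodsgz big1 ?mul1r => [|i _]; last first.
  by rewrite big1 // => j ij; rewrite !mxE gtr0_sgz //; move: ij; lia.
have -> : sgz ((-1) ^+ p : int) = (-1) ^+ p by case: (odd_perm p).
move=> e; apply: (@signr_inj int); rewrite /= signr_odd e sign_inversions_prod // sN.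
apply: eq_bigr => i _.
by apply: eq_bigr => j _; rewrite !mxE !nthp.
Qed.

End Inversions.

Lemma det_perm_cols (R : comNzRingType) (F : nat -> nat -> R) (N : nat) (c : seq nat) :
  perm_eq c (iota 0 N) ->
  \det (\matrix_(i < N, j < N) F i (nth 0%N c j))
  = (-1) ^+ inversions c * \det (\matrix_(i < N, j < N) F i j).
Proof.
have sN : size (iota 0 N) == N by rewrite size_iota.
move=> /(@tuple_permP _ _ _ (Tuple sN))[p /= cE].
have {}cE : c = [seq nat_of_ord (p i) | i <- enum 'I_N].
  rewrite cE; apply: eq_map => i.
  by rewrite (tnth_nth 0%N) /= nth_iota.
have nthc (j : 'I_N) : nth 0%N c j = p j.
  by rewrite cE (nth_map j) ?size_enum_ord // nth_ord_enum.
rewrite -signr_odd cE odd_perm_inversions -cE -odd_permV -det_perm mulrC -det_mulmx.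
rewrite -col_permE; congr (\det _); apply/matrixP => i j.
by rewrite !mxE nthc.
Qed.

(** * Determinants whose rows and columns are listed jointly *)

Section PairDet.

Variables (R : comNzRingType) (E : nat -> nat -> R).
Implicit Types P Q : seq (nat * nat).

(** Row and column labels are stored together, so that reordering the list permutes rows and columns
    alike and costs no sign. *)
Definition pair_det P : R :=
  \det (\matrix_(i < size P, j < size P)
    E (nth (0, 0)%N P i).1 (nth (0, 0)%N P j).2).

Lemma pair_det_perm P Q : perm_eq P Q -> pair_det P = pair_det Q.
Proof.
move=> PQ; rewrite /pair_det (perm_size PQ).
case/(@tuple_permP _ _ _ (in_tuple Q)): PQ => p PE.
have nthP (i : 'I_(size Q)) : nth (0, 0)%N P i = nth (0, 0)%N Q (p i).
  by rewrite PE -(tnth_nth _ _ i) tnth_mktuple (tnth_nth (0, 0)%N).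
set M := (X in _ = \det X); transitivity (\det (row_perm p (col_perm p M))).
  by congr (\det _); apply/matrixP => i j; rewrite !mxE !nthP.
rewrite row_permE det_mulmx col_permE det_mulmx !det_perm odd_permV mulrCA.
by rewrite -signr_addb addbb mulr1.
Qed.

(** The hypothesis kills the upper right block, so the matrix is block lower triangular. *)
Lemma pair_det_cat P Q :
  (forall x y, x \in P -> y \in Q -> E x.1 y.2 = 0) ->
  pair_det (P ++ Q) = pair_det P * pair_det Q.
Proof.
move=> PQ0; rewrite /pair_det size_cat.
set M := (X in \det X); rewrite -(submxK M) (_ : ursubmx M = 0); last first.
  apply/matrixP => i j; rewrite !mxE !nth_cat /= ltn_ord ltnNge leq_addr addKn.
  by rewrite PQ0 // mem_nth.
rewrite det_lblock; congr (_ * _); congr determinant; apply/matrixP => i j; rewrite !mxE.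
  by rewrite !nth_cat /= !ltn_ord.
by rewrite !nth_cat /= !ltnNge !leq_addr !addKn.
Qed.

End PairDet.

(* Every term of the Leibniz expansion vanishes: a permutation mapping [I]
   into [J] and its complement into that of [J] would make them equinumerous. *)
Lemma det_unbalanced (R : comNzRingType) (N : nat) (M : 'M[R]_N) (I J : pred 'I_N) :
  (forall i j, I i != J j -> M i j = 0) -> #|I| != #|J| -> \det M = 0.
Proof.
move=> M0 IJ; rewrite /determinant big1 // => p _.
have [i ip|all] := pickP (fun i => I i != J (p i)).
  by rewrite (bigD1 i) //= M0 // mul0r mulr0.
case/eqP: IJ; rewrite -(card_image (@perm_inj _ p)); apply: eq_card => j.
apply/imageP/idP => [[i Ii ->]|Jj].
  by move: (all i) => /negbFE/eqP; rewrite -!topredE /= => <-.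
exists (p^-1%g j); last by rewrite permKV.
by move: (all (p^-1%g j)) => /negbFE/eqP; rewrite permKV -!topredE /= => ->.
Qed.

Local Open Scope nat_scope.

(** * Beads and cores *)

Lemma part_anti lam i j :
  is_partition lam -> i <= j -> nth 0 lam j <= nth 0 lam i.
Proof.
move=> /andP[srt _] ij; have [js|js] := ltnP j (size lam); last first.
  by rewrite (nth_default _ js).
apply: (@sorted_leq_nth _ geq _ _ 0 lam srt) => //.
- by move=> x y z yx xz; apply: leq_trans xz yx.
- by move=> x; exact: leqnn.
- by rewrite inE (leq_ltn_trans ij).
Qed.

Lemma nth_part_gt0 lam i : is_partition lam -> (0 < nth 0 lam i) = (i < size lam).
Proof.
move=> /andP[_ n0]; have [ilt|ige] := ltnP i (size lam); last by rewrite nth_default.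
by rewrite lt0n; apply: contraNneq n0 => <-; rewrite mem_nth.
Qed.

(** In a decreasing list the zeros come last, where the default value 0 of [nth] replaces them. *)
Lemma nth_filter_nz s i :
  sorted geq s -> nth 0 [seq x <- s | x != 0] i = nth 0 s i.
Proof.
elim: s i => [|x s IH] i //= srt.
have tr : transitive geq by move=> a b c ba ac; apply: leq_trans ac ba.
have [x0|x0] := eqVneq x 0 => /=; last first.
  by case: i => //= i; rewrite IH //; apply: path_sorted srt.
have s0 : all (pred1 0) s.
  apply/allP => y ys; have /allP/(_ y ys) := order_path_min tr srt.
  by rewrite x0 /= leqn0.
have -> : [seq y <- s | y != 0] = [::].
  rewrite (@eq_in_filter _ _ pred0) ?filter_pred0 // => y ys.
  by move/allP/(_ y ys): s0 => /= ->.
rewrite nth_nil; case: i => [|i] /=; first by rewrite x0.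
have [il|il] := ltnP i (size s); last by rewrite nth_default.
by have /allP/(_ _ (mem_nth 0 il))/eqP := s0.
Qed.

Lemma filter_nz_partition s : sorted geq s -> is_partition [seq x <- s | x != 0].
Proof.
move=> srt; apply/andP; split; last by rewrite mem_filter eqxx.
by apply: sorted_filter srt => a b c ba ac; apply: leq_trans ac ba.
Qed.

Lemma sumn_nth s N : size s <= N -> sumn s = \sum_(0 <= i < N) nth 0 s i.
Proof.
move=> sN; rewrite (big_cat_nat (n := size s)) //= [X in _ + X]big_nat_cond.
rewrite [X in _ + X]big1 ?addn0 => [|i /andP[/andP[si _] _]]; last exact: nth_default.
by rewrite sumnE (big_nth 0).
Qed.

(** * Removal of a ribbon as the move of one bead *)

Definition bead lam N i := nth 0 lam i + N - i.+1.

Lemma mem_beta lam N x :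
  reflect (exists2 i, i < N & x = bead lam N i) (x \in beta lam N).
Proof.
apply: (iffP mapP) => -[i].
  by rewrite mem_iota => iN ->; exists i.
by move=> iN ->; exists i; rewrite ?mem_iota.
Qed.

Lemma bead_anti lam N i j :
  is_partition lam -> i < j < N -> bead lam N j < bead lam N i.
Proof.
move=> pl /andP[ij jN]; have := part_anti pl (ltnW ij).
by rewrite /bead; lia.
Qed.

Lemma bead_inj lam N i j : is_partition lam -> i < N -> j < N ->
  bead lam N i = bead lam N j -> i = j.
Proof.
move=> pl iN jN e; have [ij|ji|//] := ltngtP i j.
- by have := @bead_anti lam N i j pl; rewrite ij jN e ltnn => /(_ isT).
- by have := @bead_anti lam N j i pl; rewrite ji iN e ltnn => /(_ isT).
Qed.

Lemma beta_uniq lam N : is_partition lam -> uniq (beta lam N).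
Proof.
move=> pl; rewrite map_inj_in_uniq ?iota_uniq // => i j.
by rewrite !mem_iota => iN jN; apply: bead_inj.
Qed.

Lemma mresE t lam N r :
  mres t lam N r = \sum_(0 <= i < N) (bead lam N i %% t == r).
Proof.
rewrite /mres /beta -sum1_count big_map big_mkcond /index_iota subn0.
by apply: eq_bigr => i _; rewrite /bead; case: eqP.
Qed.

Lemma sum_bead lam N : size lam <= N ->
  \sum_(0 <= i < N) bead lam N i = sumn lam + \sum_(0 <= i < N) (N - i.+1).
Proof.
move=> sN; rewrite (sumn_nth sN) -big_split /=.
rewrite big_nat_cond [RHS]big_nat_cond; apply: eq_bigr => i.
by rewrite /bead andbT; lia.
Qed.

(* [nu] is [mu] with each row in [p..q-1] replaced by the next row shortened by
   one cell, and with a new row [q]: on beads, [bead mu p] becomes [bead nu q]. *)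
Definition strip (mu nu : seq nat) p q :=
  (forall i, (i < p) || (q < i) -> nth 0 nu i = nth 0 mu i) /\
  (forall i, p <= i < q -> nth 0 mu i.+1 = (nth 0 nu i).+1).

(** Apart from row [q] of [nu] and row [p] of [mu], the two partitions have the same beads; those in
    between only change row. An arbitrary [F] serves both for sums of beads and for counts by
    residue. *)
Lemma strip_sum mu nu p q N (F : nat -> nat) :
  p <= q < N -> strip mu nu p q ->
  \sum_(0 <= i < N) F (bead nu N i) + F (bead mu N p)
  = \sum_(0 <= i < N) F (bead mu N i) + F (bead nu N q).
Proof.
move=> /andP[pq qN] [out mid].
have eout i : (i < p) || (q < i) -> bead nu N i = bead mu N i.
  by move=> /out; rewrite /bead => ->.
have emid i : p <= i < q -> bead mu N i.+1 = bead nu N i.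
  by move=> /mid; rewrite /bead => ->; lia.
have pN : p < N by apply: leq_ltn_trans qN.
rewrite (big_cat_nat (n := p)) ?(ltnW pN) //= [in RHS](big_cat_nat (n := p)) ?(ltnW pN) //=.
rewrite (big_cat_nat (n := q.+1) (m := p)) ?(leqW pq) //=.
rewrite [in RHS](big_cat_nat (n := q.+1) (m := p)) ?(leqW pq) //=.
rewrite (big_nat_recr q) //= (big_nat_recl q) //=.
rewrite (eq_big_nat _ _ (F2 := fun i => F (bead mu N i))) => [|i ip]; last first.
  by rewrite eout //; lia.
rewrite [X in _ + (_ + X) + _ = _](eq_big_nat _ _ (F2 := fun i => F (bead mu N i))).
  rewrite [X in _ = _ + (_ + X + _) + _](eq_big_nat _ _ (F2 := fun i => F (bead nu N i))).
    by lia.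
  by move=> i ipq; rewrite emid.
by move=> i /andP[qi _]; rewrite eout // qi orbT.
Qed.

(** Some step of the path leaves the rows up to [i]. It is vertical, from row [i] to row [i.+1], and
    so keeps the column. *)
Lemma path_cross (P : pred (nat * nat)) i c s :
  path adjacent c s -> all P s -> P c -> c.1 <= i < (last c s).1 ->
  exists j, P (i, j) && P (i.+1, j).
Proof.
elim: s c => [|e s IH] c /=; first by lia.
move=> /andP[ce es] /andP[Pe Ps] Pc /andP[ci il].
have [ei|ei] := leqP e.1 i; first by apply: (IH e) => //; rewrite ei.
move: c e ci il ce Pe Pc ei {IH es} => [c1 c2] [e1 e2] /= ci _.
rewrite /adjacent /= => ce Pe Pc ei; exists c2.
have -> : i = c1 by lia.
have <- : e1 = c1.+1 by lia.
have e22 : e2 = c2 by lia.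
by rewrite Pc -{1}e22.
Qed.

Lemma subdiagram mu nu : (forall c, in_diagram nu c -> in_diagram mu c) ->
  forall i, nth 0 nu i <= nth 0 mu i.
Proof.
move=> sub i; rewrite leqNgt; apply/negP => lt.
by have := sub (i, nth 0 mu i) lt; rewrite /in_diagram /= ltnn.
Qed.

Lemma subpart_size mu nu : is_partition mu -> is_partition nu ->
  (forall i, nth 0 nu i <= nth 0 mu i) -> size nu <= size mu.
Proof.
move=> pm pn sub; rewrite leqNgt -(nth_part_gt0 _ pn) -leqNgt.
by apply: leq_trans (sub _) _; rewrite nth_default.
Qed.

(** [p] and [q] are the first and the last row meeting the skew shape. Connectedness makes
    consecutive rows share a column, and a second shared column would give a 2 x 2 square. *)
Lemma ribbon_strip t mu nu : 0 < t -> is_partition mu -> remove_ribbon t mu nu ->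
  exists p q, p <= q < size mu /\ strip mu nu p q.
Proof.
move=> t0 pm [[pn /subdiagram sub] sumE conn no22].
pose S i := nth 0 nu i < nth 0 mu i.
have exS : exists i, S i.
  apply/not_existsP => noS; have := sumE.
  rewrite (sumn_nth (leqnn _)) (sumn_nth (subpart_size pm pn sub)).
  rewrite (eq_bigr (nth 0 nu)) => [|i _]; first by lia.
  by apply/eqP; rewrite eqn_leq sub andbT leqNgt; apply/negP/noS.
have bS i : S i -> i <= (size mu).-1.
  by move=> Si; have := nth_part_gt0 i pm; rewrite /S in Si; lia.
case: (ex_minnP exS) => p Sp minp; case: (ex_maxnP exS bS) => q Sq maxq.
have sq : q < size mu by rewrite -(nth_part_gt0 _ pm); apply: leq_ltn_trans Sq.
exists p, q; rewrite minp // sq; split=> //; split=> i io.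
  apply/eqP; rewrite eqn_leq sub /= leqNgt; apply/negP => Si.
  by have := minp _ Si; have := maxq _ Si; lia.
have skS k : S k -> in_skew mu nu (k, nth 0 nu k).
  by rewrite /in_skew /in_diagram /= ltnn andbT.
have [s [ps als ls]] := conn _ _ (skS p Sp) (skS q Sq).
have [|j] := path_cross ps als (skS p Sp) (i := i); first by rewrite ls.
rewrite /in_skew /in_diagram /= -!leqNgt => /andP[/andP[j1 j2] /andP[j3 j4]].
(* The square at the first skew cell of row [i] bounds row [i.+1] of [mu] from above; the shared
   column [j] bounds it from below. *)
have := no22 i (nth 0 nu i); rewrite /in_skew /in_diagram /= -!leqNgt.
have := part_anti pm (leqnSn i); have := part_anti pn (leqnSn i).
by lia.
Qed.

(** [strip_sum] for the identity shows that the moved bead drops by [t], the size of the ribbon; for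
    a residue indicator it then shows that no count changes. *)
Lemma ribbon_mres t mu nu N : 0 < t -> is_partition mu -> size mu <= N ->
  remove_ribbon t mu nu ->
  [/\ is_partition nu, size nu <= N & forall r, mres t nu N r = mres t mu N r].
Proof.
move=> t0 pm sN rib; have [p [q [/andP[pq qs] st]]] := ribbon_strip t0 pm rib.
case: rib => -[pn /subdiagram sub] sumE _ _.
have sn : size nu <= N by apply: leq_trans (subpart_size pm pn sub) sN.
have pqN : p <= q < N by rewrite pq (leq_trans qs).
have := strip_sum id pqN st; rewrite !sum_bead // sumE => e.
have {}e : bead mu N p = bead nu N q + t by lia.
split=> // r; rewrite !mresE.
have := strip_sum (fun x => nat_of_bool (x %% t == r)) pqN st.
by rewrite e modnDr; lia.
Qed.

Section Connected.

Variable P : pred (nat * nat).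

Definition linked c d :=
  exists s, [/\ path adjacent c s, all P s & last c s = d].

Lemma linked_trans c d e : linked c d -> linked d e -> linked c e.
Proof.
move=> [s [ps als ls]] [u [pu alu lu]]; exists (s ++ u).
by rewrite cat_path all_cat last_cat ls ps als pu.
Qed.

(** [linked] constrains the cells of the path after its start only, so it is not visibly symmetric;
    carrying both directions avoids reversing paths. *)
Definition bilinked c d := linked c d /\ linked d c.

Lemma bilinked_trans c d e : bilinked c d -> bilinked d e -> bilinked c e.
Proof. by move=> [? ?] [? ?]; split; [apply: (@linked_trans _ d)..]. Qed.

Lemma bilinked_refl c : bilinked c c.
Proof. by split; exists [::]. Qed.

Lemma bilinked_adjacent c d : P c -> P d -> adjacent c d -> bilinked c d.
Proof.
move=> Pc Pd cd; split; [exists [:: d] | exists [:: c]]; rewrite /= ?Pc ?Pd ?cd //.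
split=> //; rewrite andbT; move: cd; rewrite /adjacent; lia.
Qed.

End Connected.

(** Converse of [ribbon_strip]. Each cell is linked to the first skew cell of its row, and from
    there row by row up to the first skew cell of row [p]. *)
Lemma strip_ribbon mu nu p q t : 0 < t -> is_partition mu -> is_partition nu ->
  p <= q -> strip mu nu p q -> nth 0 mu q.+1 <= nth 0 nu q < nth 0 mu q ->
  sumn mu = sumn nu + t -> remove_ribbon t mu nu.
Proof.
move=> t0 pm pn pq [out mid] /andP[q1 q2] sumE.
have sub i : nth 0 nu i <= nth 0 mu i.
  have [/out-> //|] := boolP ((i < p) || (q < i)).
  rewrite negb_or -!leqNgt => /andP[pi iq]; have [->|iq'] := eqVneq i q; first exact: ltnW.
  have := mid i; have := part_anti pm (leqnSn i); lia.
have row c : in_skew mu nu c -> p <= c.1 <= q.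
  rewrite /in_skew /in_diagram => sk; have := out c.1; lia.
have inc i : p <= i <= q -> in_skew mu nu (i, nth 0 nu i).
  move=> /andP[pi iq]; rewrite /in_skew /in_diagram /= ltnn andbT.
  have [->|iq'] := eqVneq i q; first exact: q2.
  have := mid i; have := part_anti pm (leqnSn i); lia.
have hor k i : in_skew mu nu (i, nth 0 nu i + k) ->
    bilinked (in_skew mu nu) (i, nth 0 nu i + k) (i, nth 0 nu i).
  elim: k => [|k IH] sk; first by rewrite addn0; exact: bilinked_refl.
  have sk' : in_skew mu nu (i, nth 0 nu i + k).
    by move: sk; rewrite /in_skew /in_diagram /=; lia.
  apply: bilinked_trans (IH sk'); apply: bilinked_adjacent => //.
  by rewrite /adjacent /=; lia.
have lnk c : in_skew mu nu c -> bilinked (in_skew mu nu) c (p, nth 0 nu p).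
  move: c => [i j] sk; have := row _ sk; move=> /= /andP[pi iq].
  have ij : j = nth 0 nu i + (j - nth 0 nu i).
    by move: sk; rewrite /in_skew /in_diagram /=; lia.
  rewrite ij in sk *; apply: bilinked_trans (hor _ _ sk) _.
  move: pi iq; rewrite -(subnK (m := p) (n := i)); last by case/andP: (row _ sk).
  elim: (i - p) => [|k IH] _ kq; first by rewrite add0n; exact: bilinked_refl.
  apply: bilinked_trans (IH _ _); [|lia|lia].
  set i' := k + p; rewrite addSn -/i' in kq *.
  (* Rows [i'] and [i'.+1] of the skew shape share just the column [nth 0 nu i'], through which the
     path has to go up. *)
  have m1 : nth 0 mu i'.+1 = (nth 0 nu i').+1 by apply: mid; lia.
  have n1 := part_anti pn (leqnSn i').
  have sk2 : in_skew mu nu (i'.+1, nth 0 nu i'.+1 + (nth 0 nu i' - nth 0 nu i'.+1)).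
    by rewrite /in_skew /in_diagram /=; lia.
  have [b1 b2] := hor _ _ sk2; apply: (@bilinked_trans _ _ _ _ (conj b2 b1)).
  apply: bilinked_adjacent => //; first by apply: inc; lia.
  by rewrite /adjacent /=; lia.
split=> //.
- by split=> // c; rewrite /in_diagram => /leq_trans; apply; apply: sub.
- by move=> c d /lnk[l1 _] /lnk[_ l2]; apply: linked_trans l1 l2.
move=> i j; apply/negP => /and4P[sk1 _ _ sk2].
have /= := row _ sk1; have /= := row _ sk2; have := mid i; move: sk1 sk2.
by rewrite /in_skew /in_diagram /=; lia.
Qed.

(** If [x] were a gap, sliding the bead [x + t] down to [x] would remove a [t]-ribbon. The bead
    leaves row [p] and lands in row [q], the last row whose bead exceeds [x]. *)
Lemma core_flush t mu N x : 0 < t -> is_partition mu -> size mu <= N ->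
  (forall nu, ~ remove_ribbon t mu nu) ->
  x + t \in beta mu N -> x \in beta mu N.
Proof.
move=> t0 pm sN norib /mem_beta[p pN xp]; apply/negPn/negP => xn.
pose S i := (i < N) && (x < bead mu N i).
have exS : exists i, S i by exists p; rewrite /S pN; lia.
have bS i : S i -> i <= N by case/andP => /ltnW.
case: (ex_maxnP exS bS) => q /andP[qN qx] maxq.
have pq : p <= q by apply: maxq; rewrite /S pN; lia.
have below i : q < i < N -> bead mu N i < x.
  move=> /andP[qi iN]; rewrite ltn_neqAle leqNgt; apply/andP; split.
    by apply: contraNneq xn => <-; apply/mem_beta; exists i.
  by apply/negP => xi; have := maxq i; rewrite /S iN xi leqNgt qi => /(_ isT).
(* The new row [q] must have bead [x], hence length [x + q.+1 - N]; here the subtraction is seen to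
   be exact and the length at least that of the next row. *)
have xq : N <= x + q.+1 /\ nth 0 mu q.+1 <= x + q.+1 - N.
  have [qN1|qN1] := ltnP q.+1 N; last by rewrite nth_default; lia.
  by have := below q.+1; rewrite /bead; lia.
have qx' : x + q.+1 - N < nth 0 mu q by move: qx; rewrite /bead; lia.
(* The row lengths that [strip] dictates; [nu] drops the zeros among them. *)
pose f i := if (i < p) || (q < i) then nth 0 mu i
            else if i < q then (nth 0 mu i.+1).-1 else x + q.+1 - N.
pose s := mkseq f N; pose nu := [seq y <- s | y != 0].
have srt : sorted geq s.
  apply/(sortedP 0) => i; rewrite size_mkseq => iN.
  rewrite !nth_mkseq ?(ltnW iN) // /f.
  have a1 := part_anti pm (leqnSn i); have a2 := part_anti pm (leqnSn i.+1).
  have a3 : i = q -> nth 0 mu i.+1 = nth 0 mu q.+1 by move->.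
  have a4 : i = q -> nth 0 mu i = nth 0 mu q by move->.
  have a5 : i.+1 = q -> nth 0 mu i.+1 = nth 0 mu q by move->.
  by do ![case: ifP => ?]; lia.
have nuE i : nth 0 nu i = f i.
  rewrite nth_filter_nz //; have [iN|Ni] := ltnP i N; first by rewrite nth_mkseq.
  rewrite nth_default ?size_mkseq // /f ifT ?nth_default //; last by lia.
  by apply: leq_trans sN Ni.
have pn : is_partition nu by apply: filter_nz_partition.
have st : strip mu nu p q.
  split=> i ipq; rewrite nuE /f; first by rewrite ipq.
  rewrite ifF; last by lia.
  rewrite ifT; last by lia.
  have := @part_anti mu i.+1 q pm; lia.
have nuq : nth 0 nu q = x + q.+1 - N by rewrite nuE /f ifF ?ltnn //; lia.
apply: (norib nu); apply: (strip_ribbon t0 pm pn pq st); first by rewrite nuq; lia.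
have sn : size nu <= N.
  by rewrite size_filter (leq_trans (count_size _ _)) // size_mkseq.
have pqN : p <= q < N by rewrite pq qN.
have := strip_sum id pqN st; rewrite !sum_bead // -xp /bead nuq; lia.
Qed.

Lemma core_partition t lam core N : 0 < t -> is_partition lam -> size lam <= N ->
  remove_ribbons t lam core ->
  [/\ is_partition core, size core <= N & forall r, mres t core N r = mres t lam N r].
Proof.
move=> t0 pl sN; elim=> [//|mu nu _ [pm sm em] rib].
have [pn sn en] := ribbon_mres t0 pm sm rib.
by split=> // r; rewrite en em.
Qed.

Lemma mem_xires t lam N r k : r < t ->
  (k \in xires t lam N r) = (k * t + r \in beta lam N).
Proof.
move=> rt; apply/mapP/idP => [[x]|kb].
  by rewrite mem_filter => /andP[/eqP <- xb] ->; rewrite -divn_eq.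
exists (k * t + r); first by rewrite mem_filter kb modnMDl modn_small ?eqxx.
by rewrite divnMDl ?divn_small ?addn0 //; lia.
Qed.

Lemma xires_uniq t lam N r : is_partition lam -> uniq (xires t lam N r).
Proof.
move=> pl; rewrite map_inj_in_uniq ?filter_uniq ?beta_uniq // => x y.
rewrite !mem_filter => /andP[/eqP xr _] /andP[/eqP yr _] e.
by rewrite (divn_eq x t) (divn_eq y t) e xr yr.
Qed.

Lemma size_xires t lam N r : size (xires t lam N r) = mres t lam N r.
Proof. by rewrite size_map size_filter. Qed.

(** If some [k < size s] were missing, closure under predecessors would confine [s] to the numbers
    below [k], which are too few. *)
Lemma downward_uniq_iota s : uniq s -> (forall k, k.+1 \in s -> k \in s) ->
  perm_eq s (iota 0 (size s)).
Proof.
move=> us down.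
have down' k j : j + k \in s -> k \in s by elim: j => // j IH /down /IH.
have sub : {subset iota 0 (size s) <= s}.
  move=> k; rewrite mem_iota add0n /= => ks; apply: contraLR ks => kns; rewrite -leqNgt.
  rewrite -[leqRHS](size_iota 0); apply: uniq_leq_size => // j js.
  rewrite mem_iota add0n /= ltnNge; apply: contra kns => kj.
  by apply: (@down' _ (j - k)); rewrite subnK.
have [|_ e] := uniq_min_size (iota_uniq _ _) sub; first by rewrite size_iota.
by apply: uniq_perm; rewrite ?iota_uniq // => k; rewrite e.
Qed.

Lemma xires_core t mu N r : 0 < t -> is_partition mu -> size mu <= N ->
  (forall nu, ~ remove_ribbon t mu nu) -> r < t ->
  perm_eq (xires t mu N r) (iota 0 (mres t mu N r)).
Proof.
move=> t0 pm sN norib rt; rewrite -size_xires.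
apply: downward_uniq_iota => [|k]; first exact: xires_uniq.
by rewrite !mem_xires // mulSn -addnA addnC; apply: core_flush norib.
Qed.

Lemma mem_beta_core t mu N r k : 0 < t -> is_partition mu -> size mu <= N ->
  (forall nu, ~ remove_ribbon t mu nu) -> r < t ->
  (k * t + r \in beta mu N) = (k < mres t mu N r).
Proof.
move=> t0 pm sN norib rt; rewrite -mem_xires //.
by rewrite (perm_mem (xires_core t0 pm sN norib rt)) mem_iota.
Qed.

Lemma count_residues t (a : pred nat) s : 0 < t ->
  count a s = \sum_(0 <= r < t) count (fun x => a x && (x %% t == r)) s.
Proof.
move=> t0; elim: s => [|x s IH] /=; first by rewrite big1.
rewrite IH big_split /=; congr (_ + _).
rewrite (bigD1_seq (x %% t)) ?iota_uniq ?mem_iota /= ?subn0 ?ltn_pmod // eqxx andbT.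
by rewrite big1 ?addn0 // => r; rewrite eq_sym => /negPf->; rewrite andbF.
Qed.

Lemma sum_mres t lam N : 0 < t -> \sum_(0 <= r < t) mres t lam N r = N.
Proof.
move=> t0; have := count_residues predT (beta lam N) t0.
by rewrite count_predT size_map size_iota => <-.
Qed.

Lemma count_ltn_iota k N : count (fun i => i < k) (iota 0 N) = minn k N.
Proof. by elim: N => [|N IH]; rewrite ?minn0 // -addn1 iotaD count_cat IH /=; lia. Qed.

(** In a decreasing list the entries larger than [j] come first, so their number tells which they
    are. *)
Lemma conj_nth lam i j : is_partition lam ->
  (i < nth 0 (conj_part lam) j) = (j < nth 0 lam i).
Proof.
move=> pl.
have cnt s : sorted geq s -> (i < count (fun x => j < x) s) = (j < nth 0 s i).
  elim: s i {pl} => [|x s IH] i //= srt; first by rewrite nth_nil.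
  have /IH{}IH := path_sorted srt.
  have tr : transitive geq by move=> a b c ba ac; apply: leq_trans ac ba.
  have [jx|xj] := ltnP j x; first by case: i => [|i] //=; rewrite add1n ltnS IH.
  rewrite add0n; have -> : count (fun x => j < x) s = 0.
    apply/eqP; rewrite -leqn0 leqNgt -has_count; apply/hasPn => y ys.
    have /allP/(_ y ys) /= := order_path_min tr srt; lia.
  case: i => [|i] /=; first by rewrite [j < x]ltnNge xj.
  rewrite ltn0; apply/esym/negbTE; rewrite -leqNgt.
  have [il|il] := ltnP i (size s); last by rewrite nth_default.
  by have /allP/(_ _ (mem_nth 0 il)) /= := order_path_min tr srt; lia.
have [jh|hj] := ltnP j (head 0 lam).
  rewrite (nth_map 0) ?size_iota // nth_iota // add0n; apply: cnt.
  by case/andP: pl.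
rewrite nth_default ?size_map ?size_iota // ltn0; apply/esym/negbTE; rewrite -leqNgt.
by apply: leq_trans (part_anti pl (leq0n i)) _; rewrite nth0.
Qed.

(** The numbers [N + j - nth 0 (conj_part lam) j] are gaps: by [conj_nth], the differences of row
    [i] with [j] and of column [j] with [i] are both positive or both nonpositive, so they never sum
    to 1. *)
Lemma conj_bead lam N i j : is_partition lam -> i < N -> j < N ->
  nth 0 lam i + N - i.+1 + nth 0 (conj_part lam) j <> N + j.
Proof. by move=> pl iN jN; have := conj_nth i j pl; lia. Qed.

(** * Self-conjugacy and rank of a core in terms of its bead counts *)

Section Core.

Variables (t n : nat) (mu : seq nat).
Hypotheses (t0 : 0 < t) (pm : is_partition mu) (sN : size mu <= n * t).
Hypothesis norib : forall nu, ~ remove_ribbon t mu nu.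

Local Notation N := (n * t).
Local Notation m := (mres t mu N).

Let memb r k : r < t -> (k * t + r \in beta mu N) = (k < m r).
Proof. exact: mem_beta_core. Qed.

(** Self-conjugacy bounds the largest part by [N], so every bead is below [2 N]. *)
Lemma self_conj_core_le r : conj_part mu = mu -> r < t -> m r <= n.*2.
Proof.
move=> cc rt; rewrite leqNgt -memb //; apply/negP => /mem_beta[i iN].
have := conj_nth N 0 pm; have := part_anti pm (leq0n i).
have := part_anti pm (leq0n N); rewrite cc.
have -> : nth 0 mu N = 0 by rewrite nth_default.
by rewrite /bead -muln2; nia.
Qed.

Lemma self_conj_core r : conj_part mu = mu -> r < t -> m r + m (t - r.+1) = n.*2.
Proof.
move=> cc rt.
have le2 r' : r' < t -> m r' + m (t - r'.+1) <= n.*2.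
  move=> r't; rewrite leqNgt; apply/negP => gt2.
  have le1 := self_conj_core_le cc r't.
  have rt2 : t - r'.+1 < t by lia.
  have le3 := self_conj_core_le cc rt2.
  (* The topmost bead of residue [r'] and its mirror image, of the opposite residue: they sum to
     [2 N - 1], which [conj_bead] forbids. *)
  have b1 : (m r').-1 * t + r' \in beta mu N by rewrite memb //; lia.
  have b2 : (n.*2 - m r') * t + (t - r'.+1) \in beta mu N by rewrite memb //; lia.
  case/mem_beta: b1 => i iN e1; case/mem_beta: b2 => j jN e2.
  have := conj_bead pm iN jN; rewrite cc; apply.
  have e : bead mu N i + bead mu N j = (n.*2).-1 * t + t.-1.
    rewrite -e1 -e2 addnACA -mulnDl; congr (_ * _ + _); lia.
  have : (n.*2).-1 * t + t = N.*2.
    by rewrite doubleMl -{2}(prednK (_ : 0 < n.*2)) ?mulSn; lia.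
  by move: e; rewrite /bead; lia.
(* Since the [m r] add up to [N], the nonnegative deficits sum to 0, so each inequality is an
   equality. *)
have sumE : \sum_(0 <= r' < t) (n.*2 - (m r' + m (t - r'.+1))) = 0.
  rewrite big_nat sumnB -?big_nat; last by move=> r' /andP[_ r't]; exact: le2.
  rewrite sum_nat_const_nat big_split /= [X in _ - (_ + X)]big_nat_rev /=.
  rewrite [X in _ - (_ + X)](eq_big_nat _ _ (F2 := m)) => [|i it]; last first.
    by congr (m _); lia.
  by rewrite !sum_mres //; lia.
move/eqP: sumE; rewrite big_mkord sum_nat_eq0 => /forallP/(_ (Ordinal rt))/implyP/(_ isT)/eqP /=.
by have := le2 _ rt; lia.
Qed.

Lemma core_self_conj :
  (forall r, r < t -> m r + m (t - r.+1) = n.*2) -> conj_part mu = mu.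
Proof.
move=> mm.
have bound x : x \in beta mu N -> x < N.*2.
  rewrite {1}(divn_eq x t) memb ?ltn_pmod // => xm.
  have xn : x %/ t < n.*2 by have := mm _ (ltn_pmod x t0); lia.
  by rewrite doubleMl -ltn_divLR.
have sym x : x < N.*2 -> (x \in beta mu N) = (N.*2 - x.+1 \notin beta mu N).
  move=> xN; have xt := ltn_pmod x t0; have xn : x %/ t < n.*2.
    by rewrite ltn_divLR // -doubleMl.
  have -> : N.*2 - x.+1 = (n.*2 - (x %/ t).+1) * t + (t - (x %% t).+1).
    have := divn_eq x t; rewrite mulnBl mulSn doubleMl.
    have : (x %/ t).+1 * t <= n.*2 * t by rewrite leq_mul2r xn orbT.
    by rewrite mulSn; lia.
  rewrite {1}(divn_eq x t) !memb //; last by lia.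
  by have := mm _ xt; lia.
have mu0 : nth 0 mu 0 <= N.
  have [n0|Npos] := posnP N; first by move: sN; rewrite n0 leqn0 size_eq0 => /eqP->.
  have /bound : bead mu N 0 \in beta mu N by apply/mem_beta; exists 0.
  by rewrite /bead; lia.
have cj j : nth 0 (conj_part mu) j <= N.
  rewrite leqNgt conj_nth // nth_default //.
(* The mirror image of this number is the gap of [conj_bead]. *)
have bead_conj j : j < N -> nth 0 (conj_part mu) j + N - j.+1 \in beta mu N.
  move=> jN; have := cj j => cjN; rewrite sym; last by lia.
  apply/negP => /mem_beta[i iN]; rewrite /bead => e.
  by apply: (conj_bead pm iN jN); lia.
(* The beads of the conjugate are strictly decreasing and lie among those of [mu], so the [j]-th of
   them is at most the [j]-th bead of [mu]. *)
have le_conj j : nth 0 (conj_part mu) j <= nth 0 mu j.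
  have [Nj|jN] := leqP N j.
    suff -> : nth 0 (conj_part mu) j = 0 by [].
    apply/eqP; rewrite -leqn0 leqNgt conj_nth // -leqNgt.
    exact: leq_trans mu0 Nj.
  have: nth 0 (conj_part mu) j + N - j.+1 <= bead mu N j; last by rewrite /bead; lia.
  elim: j jN => [|j IH] jN; have /mem_beta[i iN ei] := bead_conj _ jN.
    rewrite ei; have := part_anti pm (leq0n i); rewrite /bead; lia.
  have {}IH := IH (ltnW jN).
  have cant : nth 0 (conj_part mu) j.+1 <= nth 0 (conj_part mu) j.
    rewrite leqNgt conj_nth // -leqNgt leqNgt; apply/negP => lt.
    have: nth 0 mu (nth 0 (conj_part mu) j) <= j by rewrite leqNgt -conj_nth // ltnn.
    by lia.
  have ij : j < i.
    rewrite ltnNge; apply/negP => ij; have := part_anti pm ij.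
    by move: IH ei; rewrite /bead; lia.
  by rewrite ei; have := part_anti pm ij; rewrite /bead; lia.
(* Conjugation preserves inclusion and is an involution, so an inclusion of the conjugate in [mu] is
   an equality. *)
have eqc j : nth 0 (conj_part mu) j = nth 0 mu j.
  apply/eqP; rewrite eqn_leq le_conj /= leqNgt; apply/negP => lt.
  have: nth 0 (conj_part mu) j < nth 0 mu j by [].
  rewrite -conj_nth // => /leq_trans/(_ (le_conj _)); rewrite -conj_nth //.
  by rewrite ltnn.
have s1 : size (conj_part mu) = size mu.
  rewrite size_map size_iota -nth0 -eqc.
  apply/eqP; rewrite eqn_leq leqNgt conj_nth // nth_default // ltn0 /=.
  have [->//|mu_pos] := posnP (size mu).
  by rewrite -(prednK mu_pos) conj_nth // (nth_part_gt0 _ pm) prednK.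
by apply: (@eq_from_nth _ 0) => // i _; exact: eqc.
Qed.

Lemma ltn_rk i : (i < rk mu) = (i < nth 0 mu i).
Proof.
apply/idP/idP => [|imu].
  apply: contraTT; rewrite -!leqNgt => mui; apply/bigmax_leqP => d /forallP dP.
  rewrite leqNgt; apply/negP => id; have := dP (Ordinal id) => /=; lia.
have is' : i.+1 < (size mu).+1 by rewrite ltnS -(nth_part_gt0 _ pm); lia.
apply: (@leq_bigmax_cond _ _ (fun d : 'I_(size mu).+1 => val d) (Ordinal is')).
apply/forallP => k /=; apply: leq_trans imu _; apply: part_anti => //.
by rewrite -ltnS.
Qed.

(** Row [i] meets the diagonal exactly when its bead is at least [N]. For residue [r] these are the
    beads with quotient at least [n]; truncation gives 0 when there are none. *)
Lemma rk_core : rk mu = \sum_(0 <= r < t) (m r - n).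
Proof.
have -> : rk mu = count (leq N) (beta mu N).
  rewrite count_map (@eq_in_count _ _ (fun i => i < rk mu)); last first.
    by move=> i; rewrite mem_iota ltn_rk /= /bead => iN; lia.
  have rN : rk mu <= N.
    by rewrite leqNgt ltn_rk // nth_default.
  by rewrite count_ltn_iota (minn_idPl rN).
rewrite (count_residues _ _ t0) big_nat [RHS]big_nat; apply: eq_bigr => r rt.
transitivity (count (leq n) (xires t mu N r)).
  rewrite [RHS]count_map count_filter; apply: eq_count => x /=.
  by rewrite leq_divRL.
rewrite (seq.permP (xires_core t0 pm sN norib _)); last by case/andP: rt.
have : count (leq n) (iota 0 (m r)) + minn n (m r) = m r.
  rewrite -count_ltn_iota -[RHS](size_iota 0) -[RHS](count_predC (leq n)).
  by congr (_ + _); apply: eq_count => i /=; rewrite -ltnNge.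
by move: (count _ _) => c; lia.
Qed.

(** Opposite residues together contribute the absolute value of [m r - n], which has the parity of
    [m r + n]; the middle residue contributes 0. *)
Lemma odd_rk_core : odd t -> (forall r, r < t -> m r + m (t - r.+1) = n.*2) ->
  odd (rk mu) = odd (\sum_((t.+1)./2 <= r < t) (m r + n)).
Proof.
move=> ot mm; rewrite rk_core; set h := t./2.
have tE : t = h.*2.+1 by rewrite -(odd_double_half t) ot.
have -> : (t.+1)./2 = h.+1 by rewrite tE -doubleS doubleK.
have ht : h < t by lia.
have mid : m h - n = 0 by have := mm h ht; rewrite (_ : t - h.+1 = h); lia.
have split_sum : \sum_(0 <= r < t) (m r - n)
    + (\sum_(h.+1 <= r < t) minn (m r) n).*2 = \sum_(h.+1 <= r < t) (m r + n).
  rewrite (big_cat_nat (n := h)) ?(ltnW ht) //= (big_ltn ht) mid add0n.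
  rewrite big_nat_rev /= add0n.
  have shift (F : nat -> nat) : \sum_(h.+1 <= r < t) F r = \sum_(0 <= r < h) F (r + h.+1).
    by rewrite -{1}[h.+1]add0n big_addn; congr bigop; congr index_iota; lia.
  rewrite !shift -big_split /= -muln2 big_distrl -big_split /=.
  rewrite big_nat [RHS]big_nat; apply: eq_bigr => r rh.
  have := mm (h - r.+1); rewrite (_ : t - (h - r.+1).+1 = r + h.+1); last by lia.
  by move=> /(_ ltac:(lia)); lia.
by rewrite -split_sum oddD odd_double addbF.
Qed.

End Core.

(** * The permutation of the columns *)

Lemma inversions_sorted s : sorted ltn s -> inversions s = 0.
Proof.
elim: s => //= x s IH srt; rewrite IH ?(path_sorted srt) // addn0.
apply/eqP; rewrite -leqn0 leqNgt -has_count; apply/hasPn => y ys.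
by have /allP/(_ y ys) /= := order_path_min ltn_trans srt; lia.
Qed.

Section Columns.

Variables t n : nat.

(* The [k]-th bead of residue [r] is sent to the column [z] if [z >= 0] and to
   [-1 - z] otherwise, where [z = (k + n - m r) * t + (t - 1 - r)]. *)
Definition bead_col (m : nat -> nat) r k :=
  if m r <= k + n then (k + n - m r) * t + (t - r.+1) else (m r - n - k.+1) * t + r.

Definition cols m r := [seq bead_col m r k | k <- iota 0 (m r)].

Definition blocks (T : Type) (F : nat -> seq T) i L :=
  flatten [seq F r | r <- iota i L].

(** The induction step both for the sign of the columns and for the factorization of the
    determinant, which proceed from the middle residues outwards. *)
Lemma blocks_outer (T : Type) (F : nat -> seq T) i L :
  blocks F i L.+2 = F i ++ blocks F i.+1 L ++ F (i + L.+1).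
Proof.
rewrite /blocks -(addn1 L.+1) iotaD map_cat flatten_cat /= cats0 -catA.
by congr (_ ++ (_ ++ F _)); rewrite addSn addnS.
Qed.

Lemma size_cols m r : size (cols m r) = m r.
Proof. by rewrite size_map size_iota. Qed.

Hypothesis t0 : 0 < t.

(** The right-hand side does not involve [m]: this word is the same for all admissible counts, as
    [inversions_outer] requires. *)
Lemma rev_cat_cols m r : r < t -> m r + m (t - r.+1) = n.*2 ->
  rev (cols m (t - r.+1)) ++ cols m r
  = [seq if n <= y then (y - n) * t + (t - r.+1) else (n - y.+1) * t + r
    | y <- iota 0 n.*2].
Proof.
move=> rt mm; apply: (@eq_from_nth _ 0).
  by rewrite size_cat size_rev !size_cols size_map size_iota addnC.
move=> y; rewrite size_cat size_rev !size_cols addnC mm => yn.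
rewrite nth_cat size_rev size_cols (nth_map 0) ?size_iota // nth_iota // add0n.
case: ltnP => ym.
  rewrite nth_rev ?size_cols // (nth_map 0) ?size_iota; last by lia.
  rewrite nth_iota; last by lia.
  rewrite add0n /bead_col (_ : t - (t - r.+1).+1 = r); last by lia.
  case: (leqP n y) => ny.
    by rewrite ifF; [congr (_ * _ + _) | ]; lia.
  by rewrite ifT; [congr (_ * _ + _) | ]; lia.
rewrite (nth_map 0) ?size_iota; last by lia.
rewrite nth_iota ?add0n /bead_col; last by lia.
case: (leqP n y) => ny.
  by rewrite ifT; [congr (_ * _ + _) | ]; lia.
by rewrite ifF; [congr (_ * _ + _) | ]; lia.
Qed.

Lemma perm_cols m :
  (forall r, r < t -> m r + m (t - r.+1) = n.*2) ->
  \sum_(0 <= r < t) m r = n * t -> perm_eq (blocks (cols m) 0 t) (iota 0 (n * t)).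
Proof.
move=> mm sm.
have sz : size (blocks (cols m) 0 t) = n * t.
  rewrite size_flatten /shape -map_comp sumnE big_map -sm /index_iota subn0.
  by apply: eq_bigr => r _ /=; rewrite size_cols.
have sub : {subset iota 0 (n * t) <= blocks (cols m) 0 t}.
  move=> j; rewrite mem_iota add0n /= => jN.
  have ct := ltn_pmod j t0; set c := j %% t in ct.
  have kn : j %/ t < n by rewrite ltn_divLR.
  have mc := mm _ ct; set k := j %/ t in kn.
  have jE : j = k * t + c by rewrite {1}(divn_eq j t).
  (* Column [k * t + c] comes from residue [t - c.+1] with [z >= 0], or else from residue [c] with
     [z < 0]. *)
  apply/flatten_mapP; have [km|mk] := leqP n (k + m (t - c.+1)).
    exists (t - c.+1); first by rewrite mem_iota; lia.
    apply/mapP; exists (k + m (t - c.+1) - n); first by rewrite mem_iota; lia.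
    by rewrite jE /bead_col ifT; [congr (_ * _ + _) | ]; lia.
  exists c; first by rewrite mem_iota.
  apply/mapP; exists (m c - n - k.+1); first by rewrite mem_iota; lia.
  by rewrite jE /bead_col ifF; [congr (_ * _ + _) | ]; lia.
have szle : size (blocks (cols m) 0 t) <= size (iota 0 (n * t)) by rewrite sz size_iota.
have [_ e] := uniq_min_size (iota_uniq _ _) sub szle.
by apply: uniq_perm => [||k]; rewrite ?iota_uniq ?e // (leq_size_uniq _ sub) ?iota_uniq.
Qed.

Lemma cols_const r : cols (fun=> n) r = [seq k * t + (t - r.+1) | k <- iota 0 n].
Proof. by apply: eq_map => k; rewrite /bead_col leq_addl addnK. Qed.

(** For [r < s], column [l] of residue class [s] is smaller than column [k] of class [r] exactly
    when [l <= k]; so the count is 1 + ... + n. *)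
Lemma cross_cols_const r s : r < s < t ->
  cross (cols (fun=> n) r) (cols (fun=> n) s) = 'C(n.+1, 2).
Proof.
move=> /andP[rs st]; rewrite !cols_const /cross big_map -bin2_sum big_ltn // add0n big_add1 /=.
rewrite /index_iota subn0 big_seq [RHS]big_seq; apply: eq_bigr => k.
rewrite mem_iota /= => kn; rewrite count_map.
rewrite (@eq_count _ _ (fun l => l < k.+1)) ?count_ltn_iota; first by apply/minn_idPl.
move=> l /=; rewrite ltnS; have [lk|kl] := leqP l k.
  by have : l * t <= k * t by [rewrite leq_mul2r lk orbT]; lia.
by have : k.+1 * t <= l * t; [rewrite leq_mul2r kl orbT | rewrite mulSn; lia].
Qed.

Lemma inversions_cols_const i L : i + L <= t ->
  inversions (blocks (cols (fun=> n)) i L) = 'C(L, 2) * 'C(n.+1, 2).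
Proof.
elim: L i => [|L IH] i iL //=.
rewrite /blocks /= -/(blocks _ _ _) inversions_cat IH; last by lia.
have -> : inversions (cols (fun=> n) i) = 0.
  apply: inversions_sorted; rewrite cols_const; apply: homo_sorted (iota_ltn_sorted 0 n) => x y xy.
  by rewrite /= ltn_add2r ltn_mul2r t0.
have -> : cross (cols (fun=> n) i) (blocks (cols (fun=> n)) i.+1 L) = L * 'C(n.+1, 2).
  have crossB j L' : i < j -> j + L' <= t ->
      cross (cols (fun=> n) i) (blocks (cols (fun=> n)) j L') = L' * 'C(n.+1, 2).
    elim: L' j {IH iL} => [|L' IH] j ij jL.
      by rewrite mul0n; apply: big1 => x _.
    rewrite /blocks /= -/(blocks _ _ _) cross_catr IH ?(leqW ij) //; last by lia.
    by rewrite cross_cols_const ?mulSn //; lia.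
  by apply: crossB; lia.
by rewrite add0n (binS L) bin1 mulnDl.
Qed.

Lemma odd_inversions_cols m :
  (forall r, r < t -> m r + m (t - r.+1) = n.*2) ->
  \sum_(0 <= r < t) m r = n * t ->
  odd (inversions (blocks (cols m) 0 t))
  = odd ('C(t, 2) * 'C(n.+1, 2)
         + \sum_(uphalf t <= r < t) ('C((m r).+1, 2) + 'C(n.+1, 2) + n * t * (m r + n))).
Proof.
move=> mm sm; pose m0 (_ : nat) := n.
have mm0 r : r < t -> m0 r + m0 (t - r.+1) = n.*2 by rewrite addnn.
have sm0 : \sum_(0 <= r < t) m0 r = n * t by rewrite sum_nat_const_nat subn0 mulnC.
have u := perm_uniq (perm_cols mm sm); have u0 := perm_uniq (perm_cols mm0 sm0).
rewrite iota_uniq in u; rewrite iota_uniq in u0.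
pose h := t./2; have tE : t = h.*2 + odd t by rewrite addnC odd_double_half.
have uE : uphalf t = h + odd t by rewrite uphalf_half addnC.
(* The word of the innermost [i] pairs of residues, with the middle residue when [t] is odd. *)
pose W (m' : nat -> nat) i := blocks (cols m') (h - i) (i.*2 + odd t).
have Wh m' : W m' h = blocks (cols m') 0 t by rewrite /W subnn -tE.
have WS m' i : i < h -> W m' i.+1 =
    cols m' (h - i.+1) ++ W m' i ++ cols m' (t - (h - i.+1).+1).
  move=> ih; rewrite /W doubleS !addSn blocks_outer; congr (_ ++ (blocks _ _ _ ++ cols _ _)); lia.
suff main i : i <= h -> uniq (W m i) -> uniq (W m0 i) -> perm_eq (W m i) (W m0 i) /\
    odd (inversions (W m i)) (+) odd (inversions (W m0 i))
    = odd (\sum_(h + odd t <= r < h + odd t + i)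
             ('C((m r).+1, 2) + 'C(n.+1, 2) + n * t * (m r + n))).
  have [|||_] := main h; rewrite ?Wh // => e.
  rewrite oddD -(inversions_cols_const (i := 0)) // uE [X in \sum_(_ <= r < X) _]tE.
  by rewrite -addnn addnAC -e addbC addbK.
elim: i => [|i IH] ih uW uW0.
  rewrite addn0 big_geq // /W double0 add0n subn0.
  suff -> : blocks (cols m) h (odd t) = blocks (cols m0) h (odd t).
    by rewrite perm_refl addbb.
  case ot: (odd t) => //; rewrite /blocks /= /cols /m0 /bead_col.
  have mh : m h = n by have := mm h; rewrite (_ : t - h.+1 = h); lia.
  by rewrite mh.
have bE : h + odd t + i = t - (h - i.+1).+1 by clear -tE ih; lia.
rewrite !WS // in uW uW0 *; set a := h - i.+1 in uW uW0 *; set b := t - a.+1 in uW uW0 *.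
have a_t : a < t by clear -tE ih; lia.
have [uWi uWi0] : uniq (W m i) /\ uniq (W m0 i).
  move: uW uW0; rewrite cat_uniq => /and3P[_ _]; rewrite cat_uniq => /and3P[-> _ _].
  by rewrite cat_uniq => /and3P[_ _]; rewrite cat_uniq => /and3P[-> _ _].
have [pW oW] := IH (ltnW ih) uWi uWi0.
have rc := rev_cat_cols a_t (mm _ a_t); have rc0 := rev_cat_cols a_t (mm0 _ a_t).
have rr : rev (cols m b) ++ cols m a = rev (cols m0 b) ++ cols m0 a by rewrite rc rc0.
split.
  have pc m' : perm_eq (cols m' a ++ W m' i ++ cols m' b)
      ((rev (cols m' b) ++ cols m' a) ++ W m' i).
    rewrite perm_catCA perm_catC; apply: perm_cat => //.
    by rewrite perm_catC perm_cat2r perm_sym perm_rev.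
  rewrite (perm_trans (pc m)) // perm_sym (perm_trans (pc m0)) // rr perm_cat2l.
  by rewrite perm_sym.
rewrite (inversions_outer uW uW0 pW rr) !size_cols (perm_size pW).
have sW0 : size (W m0 i) = (i.*2 + odd t) * n.
  rewrite size_flatten /shape -map_comp sumnE big_map big_seq.
  rewrite (eq_bigr (fun=> n)) => [|r _ /=]; last by rewrite size_cols.
  by rewrite -big_seq big_const_seq count_predT size_iota iter_addn_0 mulnC.
rewrite sW0 addnS big_nat_recr ?leq_addr //=.
have mab := mm _ a_t; rewrite -/b in mab.
have oab : odd (m a) = odd (m b).
  by move/(congr1 odd): mab; rewrite oddD odd_double; odd_cases.
set S := odd (\sum_(_ <= _ < _) _) in oW *; rewrite oW [in RHS]oddD -/S.
(* Modulo 2, [m a] equals [m b] and the inner length is [n * t], so the pair contributes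
   ['C((m b).+1, 2) + n * t * m b], and likewise with [n] in place of [m b]. *)
rewrite !(binS _ 1) !bin1 !(oddD, oddM) odd_double oab oddb bE -/a -/b /m0.
by odd_cases; case: (S).
Qed.

End Columns.

(** * Quotient partitions and the sorted beta set *)

Lemma sorted_gtn_pairwise (s : seq nat) : sorted gtn s = pairwise gtn s.
Proof. by apply: sorted_pairwise => a b c ba ac; apply: ltn_trans ac ba. Qed.

(** The later entries are distinct naturals below the [k]-th one. This makes the subtraction in
    [tquotient] exact. *)
Lemma sorted_gtn_nth s k : sorted gtn s -> k < size s -> size s <= nth 0 s k + k.+1.
Proof.
elim: s k => [|x s IH] // k srt; have srt' := path_sorted srt.
case: k => [_|k] /=; last by rewrite ltnS => /(IH _ srt'); lia.
have: size s <= x; last by lia.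
elim: s x srt {IH srt'} => [|y s IH] x //= /andP[yx /IH]; lia.
Qed.

Lemma beta_sorted lam N : is_partition lam -> sorted gtn (beta lam N).
Proof.
move=> pl; apply/(sortedP 0) => i; rewrite size_map size_iota => iN.
rewrite !(nth_map 0) ?size_iota ?(ltnW iN) // !nth_iota ?(ltnW iN) //.
by have := @bead_anti lam N i i.+1 pl; rewrite ltnSn iN /bead; apply.
Qed.

Lemma xires_sorted t lam N r : is_partition lam -> sorted gtn (xires t lam N r).
Proof.
move=> /(@beta_sorted _ N); rewrite !sorted_gtn_pairwise /xires pairwise_map.
move/(pairwise_filter (fun x => x %% t == r)); apply: sub_in_pairwise (allss _) => x y.
rewrite !mem_filter => /andP[/eqP xr _] /andP[/eqP yr _] /= yx.
rewrite ltnNge; apply: contraTN yx => yx; rewrite -leqNgt.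
by rewrite (divn_eq x t) (divn_eq y t) xr yr leq_add2r leq_mul2r yx orbT.
Qed.

Lemma nth_tquotient t lam N r k : is_partition lam -> k < mres t lam N r ->
  nth 0 (tquotient t lam N r) k + mres t lam N r = nth 0 (xires t lam N r) k + k.+1.
Proof.
move=> pl; rewrite /tquotient -size_xires; have := xires_sorted t N r pl.
move: (xires t lam N r) => s srt ks.
rewrite nth_filter_nz; last first.
  apply/(sortedP 0) => i; rewrite size_map size_iota => iN.
  rewrite !(nth_map 0) ?size_iota ?(ltnW iN) // !nth_iota ?(ltnW iN) // !add0n.
  by have /(sortedP 0)/(_ i iN) /= := srt; lia.
rewrite (nth_map 0) ?size_iota // nth_iota // add0n subnK //.
exact: sorted_gtn_nth.
Qed.

Lemma size_tquotient t lam N r : size (tquotient t lam N r) <= mres t lam N r.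
Proof. by rewrite size_filter (leq_trans (count_size _ _)) // size_map size_iota. Qed.

Definition beads t lam N r :=
  [seq nth 0 (xires t lam N r) k * t + r | k <- iota 0 (mres t lam N r)].

Lemma beadsE t lam N r : beads t lam N r = [seq x <- beta lam N | x %% t == r].
Proof.
rewrite /beads -size_xires.
have -> : [seq nth 0 (xires t lam N r) k * t + r | k <- iota 0 (size (xires t lam N r))]
    = [seq q * t + r | q <- xires t lam N r].
  by rewrite -[in RHS](mkseq_nth 0 (xires t lam N r)) -map_comp.
rewrite -map_comp map_id_in // => x; rewrite mem_filter => /andP[/eqP <- _] /=.
by rewrite -divn_eq.
Qed.

Lemma perm_residues t s : 0 < t ->
  perm_eq s (blocks (fun r => [seq x <- s | x %% t == r]) 0 t).
Proof.
move=> t0; apply/seq.permP => a; rewrite (count_residues a s t0).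
rewrite count_flatten sumnE -map_comp big_map /index_iota subn0.
by apply: eq_bigr => r _ /=; rewrite count_filter.
Qed.

(** [residue_le] is a total order, so the only sorted rearrangement of the beta set is the sorted
    list. *)
Lemma sort_residues t lam N : 0 < t -> is_partition lam ->
  sort (residue_le t) (beta lam N) = blocks (beads t lam N) 0 t.
Proof.
move=> t0 pl.
have tr : transitive (residue_le t).
  by move=> y x z; rewrite /residue_le; lia.
have tot : total (residue_le t) by move=> x y; rewrite /residue_le; lia.
apply: (sorted_eq tr).
- by move=> x y; rewrite /residue_le; lia.
- exact: sort_sorted.
- apply: pairwise_sorted; suff: forall L i, pairwise (residue_le t) (blocks (beads t lam N) i L) by [].
  elim=> [|L IH] i //.
  rewrite /blocks /= -/(blocks _ _ _) pairwise_cat IH andbT; apply/andP; split.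
    apply/allrelP => x y; rewrite beadsE mem_filter => /andP[/eqP xi _].
    move=> /flatten_mapP[r]; rewrite mem_iota => /andP[ir _].
    by rewrite beadsE mem_filter => /andP[/eqP yr _]; rewrite /residue_le xi yr ir.
  rewrite beadsE; have := beta_sorted N pl; rewrite sorted_gtn_pairwise.
  move/(pairwise_filter (fun x => x %% t == i)); apply: sub_in_pairwise (allss _) => x y.
  rewrite !mem_filter => /andP[/eqP xr _] /andP[/eqP yr _] /= yx.
  by rewrite /residue_le xr yr eqxx (ltnW yx) orbT.
rewrite perm_sort /blocks; under eq_map do rewrite beadsE.
exact: perm_residues.
Qed.

(** * Blocks of the determinant *)

Local Open Scope ring_scope.

Section Entries.

Variables (t n : nat) (phi : {rmorphism symfun -> symfun}).

(** Rows are labelled by beads: row [i] of the determinant depends on [i] only through its bead [b],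
    as the part minus [i] is [b - n * t + 1]. *)
Definition entry (b j : nat) : symfun :=
  phi (hz (b%:Z - (n * t)%N%:Z + 1 + j%:Z)) + phi (hz (b%:Z - (n * t)%N%:Z - j%:Z)).

Lemma phi_so_entry lam : (size lam <= n * t)%N ->
  phi (so lam) = \det (\matrix_(i < n * t, j < n * t) entry (nth 0%N (beta lam (n * t)) i) j).
Proof.
move=> sN; rewrite -(so_detE sN) /so_det -det_map_mx; congr (\det _).
apply/matrixP => i j; rewrite !mxE rmorphD (nth_map 0%N) ?size_iota ?ltn_ord //.
rewrite nth_iota ?ltn_ord // add0n /entry /part; have := ltn_ord i.
by move: (nth _ _ _) => y iN; congr (phi (hz _) + phi (hz _)); lia.
Qed.

Hypotheses (t0 : (0 < t)%N) (phiP : is_varphi t phi).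

Lemma phi_hz (q : int) (c : nat) : (c < t)%N ->
  phi (hz (q * t%:Z + c%:Z)) = if c == 0%N then hz q else 0.
Proof.
move=> ct; case: q => q.
  have -> : Posz q * t%:Z + c%:Z = (q * t + c)%N%:Z by lia.
  rewrite /= phiP dvdn_addr ?dvdn_mull // /dvdn modn_small //.
  by case: eqP => [->|//]; rewrite addn0 mulnK.
rewrite !hz_neg ?rmorph0 ?if_same //.
by rewrite NegzE; nia.
Qed.

(** The two indices are congruent to [r + c + 1] and [r - c] modulo [t], and [phi] kills a term
    unless its index is divisible by [t]. *)
Lemma entry_residues (x r k c : nat) : (r < t)%N -> (c < t)%N ->
  entry (x * t + r) (k * t + c)
  = (if c == (t - r.+1)%N then hz (x%:Z - n%:Z + k%:Z + 1) else 0)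
    + (if c == r then hz (x%:Z - n%:Z - k%:Z) else 0).
Proof.
move=> rt ct; rewrite /entry; congr (_ + _).
  have [rc|cr] := ltnP (r + c).+1 t.
    rewrite (_ : _ + _ = (x%:Z - n%:Z + k%:Z) * t%:Z + (r + c).+1%:Z); last by lia.
    by rewrite phi_hz //= ifF //; lia.
  rewrite (_ : _ + _ = (x%:Z - n%:Z + k%:Z + 1) * t%:Z + ((r + c).+1 - t)%N%:Z); last by lia.
  rewrite phi_hz; last by lia.
  by congr (if _ then _ else _); lia.
have [cr|rc] := leqP c r.
  rewrite (_ : _ - _ = (x%:Z - n%:Z - k%:Z) * t%:Z + (r - c)%N%:Z); last by lia.
  rewrite phi_hz; last by lia.
  by congr (if _ then _ else _); lia.
rewrite (_ : _ - _ = (x%:Z - n%:Z - k%:Z - 1) * t%:Z + (t + r - c)%N%:Z); last by lia.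
rewrite phi_hz; last by lia.
by rewrite !ifF //; lia.
Qed.

Lemma entry_other (b j : nat) :
  ((j %% t == b %% t) || (j %% t == t - (b %% t).+1))%N = false -> entry b j = 0.
Proof.
move/norP => [/negPf n1 /negPf n2].
rewrite (divn_eq b t) (divn_eq j t) entry_residues ?ltn_pmod //.
by rewrite n1 n2 addr0.
Qed.

Variable m : nat -> nat.
Hypothesis mm : forall r, (r < t)%N -> (m r + m (t - r.+1) = n.*2)%N.

(** The sign of [z] in [bead_col] selects which of the two terms survives; the reflection of
    negative [z] makes both cases yield the same index. *)
Lemma entry_col_same r x l : (r < t)%N -> r != (t - r.+1)%N -> (l < m r)%N ->
  entry (x * t + r) (bead_col t n m r l) = hz (x%:Z - (m r)%:Z + 1 + l%:Z).
Proof.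
move=> rt rr lm; rewrite /bead_col; case: leqP => ml; rewrite entry_residues //; try lia.
  rewrite eqxx ifF ?addr0; first by congr hz; lia.
  by rewrite eq_sym (negPf rr).
rewrite (negPf rr) eqxx add0r; congr hz; lia.
Qed.

Lemma entry_col_opp r x l : (r < t)%N -> r != (t - r.+1)%N -> (l < m (t - r.+1))%N ->
  entry (x * t + r) (bead_col t n m (t - r.+1)%N l) = hz (x%:Z - (m r)%:Z - l%:Z).
Proof.
move=> rt rr lm; have mr := mm rt; rewrite /bead_col (_ : t - (t - r.+1).+1 = r)%N; last by lia.
case: leqP => ml; rewrite entry_residues //; try lia.
  by rewrite eqxx (negPf rr) add0r; congr hz; lia.
rewrite eqxx ifF ?addr0; first by congr hz; lia.
by rewrite eq_sym (negPf rr).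
Qed.

Lemma entry_col_mid r x l : (r < t)%N -> r = (t - r.+1)%N ->
  entry (x * t + r) (bead_col t n m r l)
  = hz (x%:Z - (m r)%:Z + 1 + l%:Z) + hz (x%:Z - (m r)%:Z - l%:Z).
Proof.
move=> rt rr; have mr := mm rt; rewrite -rr in mr.
have mrn : m r = n by lia.
rewrite /bead_col mrn leq_addl addnK -rr entry_residues // -rr eqxx.
by congr (hz _ + hz _); lia.
Qed.

Variable lam : seq nat.
Hypothesis pl : is_partition lam.
Hypothesis mE : forall r, m r = mres t lam (n * t) r.

Local Notation xi r k := (nth 0%N (xires t lam (n * t) r) k).
Local Notation quo r := (tquotient t lam (n * t) r).

Definition bead_pairs r := [seq (xi r k * t + r, bead_col t n m r k)%N | k <- iota 0 (m r)].

Lemma part_quo r k : (k < m r)%N ->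
  (xi r k)%:Z = part (quo r) k - k%:Z - 1 + (m r)%:Z.
Proof. by rewrite mE => /(nth_tquotient pl); rewrite /part; lia. Qed.

Lemma nth_bead_pairs r k : (k < m r)%N ->
  nth (0, 0)%N (bead_pairs r) k = (xi r k * t + r, bead_col t n m r k)%N.
Proof. by move=> km; rewrite (nth_map 0%N) ?size_iota // nth_iota. Qed.

(** A bead and a column of the same residue give a diagonal block of [rs], opposite residues an
    off-diagonal one. *)
Lemma pair_det_rs r : (r < t)%N -> r != (t - r.+1)%N ->
  pair_det entry (bead_pairs r ++ bead_pairs (t - r.+1)%N) = rs (quo r) (quo (t - r.+1)).
Proof.
move=> rt rr; set r' := (t - r.+1)%N.
have rt' : (r' < t)%N by rewrite /r'; lia.
have rr' : r = (t - r'.+1)%N by rewrite /r'; lia.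
have eopp x l : (l < m r')%N ->
    entry (x * t + r) (bead_col t n m r' l) = hz (x%:Z - (m r)%:Z - l%:Z).
  exact: entry_col_opp.
have eopp' x l : (l < m r)%N ->
    entry (x * t + r') (bead_col t n m r l) = hz (x%:Z - (m r')%:Z - l%:Z).
  by have := @entry_col_opp r' x l rt'; rewrite -rr' eq_sym; apply.
rewrite -(@rs_detE (m r) (m r')) ?mE ?size_tquotient // -!mE rs_det_entry.
rewrite /pair_det size_cat !size_map !size_iota; congr (\det _).
apply/matrixP => i j; rewrite !mxE !nth_cat !size_map !size_iota /rs_entry.
have iN := ltn_ord i; have jN := ltn_ord j.
case: ltnP => im; case: ltnP => jm; rewrite !nth_bead_pairs /=; try lia.
- by rewrite entry_col_same // part_quo //; congr hz; lia.
- by rewrite eopp ?part_quo //; [congr hz; lia | lia].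
- by rewrite eopp' ?part_quo //; [congr hz; lia | lia].
- by rewrite entry_col_same -?rr' ?part_quo //; [congr hz; lia | lia..].
Qed.

Lemma pair_det_so r : (r < t)%N -> r = (t - r.+1)%N ->
  pair_det entry (bead_pairs r) = so (quo r).
Proof.
move=> rt rr; rewrite -(@so_detE (m r)) ?mE ?size_tquotient // -!mE.
rewrite /pair_det !size_map !size_iota; congr (\det _).
apply/matrixP => i j; rewrite !mxE !nth_bead_pairs //=.
by rewrite entry_col_mid // part_quo //; congr (hz _ + hz _); lia.
Qed.

Lemma bead_pairs_residue r x : x \in bead_pairs r -> (r < t)%N ->
  (x.1 %% t = r /\ (x.2 %% t = r \/ x.2 %% t = t - r.+1))%N.
Proof.
move=> /mapP[k _ ->] rt /=; rewrite modnMDl modn_small //; split=> //.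
rewrite /bead_col; case: ifP => _; rewrite modnMDl modn_small; [by right|lia|by left|by []].
Qed.

Lemma pair_det_blocks i : (i <= t./2)%N ->
  pair_det entry (blocks bead_pairs (t./2 - i) (i.*2 + odd t))
  = \prod_(t./2 - i <= r < t./2) rs (quo r) (quo (t - r.+1))
    * (if odd t then so (quo t./2) else 1).
Proof.
set h := t./2; have tE : t = (h.*2 + odd t)%N by rewrite addnC odd_double_half.
elim: i => [|i IH] ih.
  rewrite subn0 big_geq // mul1r add0n; case ot: (odd t) in tE *; last first.
    by rewrite /blocks /= /pair_det det_mx00.
  by rewrite /blocks /= cats0 pair_det_so //; lia.
rewrite doubleS !addSn blocks_outer; set a := (h - i.+1)%N.
have -> : a.+1 = (h - i)%N by rewrite /a; lia.
have -> : (a + (i.*2 + odd t).+1)%N = (t - a.+1)%N by rewrite /a; lia.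
have a_t : (a < t)%N by rewrite /a; lia.
have aa : a != (t - a.+1)%N by rewrite /a; lia.
(* The two outer blocks are brought together at no cost in sign; their rows vanish on the inner
   columns. *)
rewrite (pair_det_perm _ (Q := (bead_pairs a ++ bead_pairs (t - a.+1)) ++
  blocks bead_pairs (h - i) (i.*2 + odd t))); last by rewrite -catA perm_cat3.
rewrite pair_det_cat => [|x y xP yP].
  rewrite pair_det_rs // IH ?(ltnW ih) // mulrA; congr (_ * _).
  rewrite [RHS]big_ltn; last by rewrite /a; lia.
  by congr (_ * \big[_/_]_(_ <= _ < _) _); rewrite /a; lia.
apply: entry_other; move: yP => /flatten_mapP[s]; rewrite mem_iota => sP yP.
have st : (s < t)%N by move: sP; lia.
have [_ ys] := bead_pairs_residue yP st.
have xr : (x.1 %% t = a \/ x.1 %% t = t - a.+1)%N.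
  have a_t' : (t - a.+1 < t)%N by lia.
  move: xP; rewrite mem_cat.
  by case/orP => /bead_pairs_residue; [case/(_ a_t); left | case/(_ a_t'); right].
have {}sP : (a < s < t - a.+1)%N by move: sP; rewrite /a; clear -tE ih; lia.
apply/negP => yx; clear -yx ys xr sP a_t st.
by move: yx ys xr sP; move: (x.1 %% t)%N (y.2 %% t)%N => u v; clear -a_t st; lia.
Qed.

End Entries.

(** * Vanishing criterion, parity of the sign and conclusion *)

Lemma card_ord_count (a : pred nat) N : #|[pred i : 'I_N | a i]| = count a (iota 0 N).
Proof. by rewrite -sum1_card -sum1_count -[in RHS](subn0 N) big_mkord. Qed.

Lemma count_residue_iota t n r : (r < t)%N ->
  count (fun x => x %% t == r)%N (iota 0 (n * t)) = n.
Proof.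
move=> rt; elim: n => [|n IH] //.
rewrite mulSn addnC iotaD count_cat IH add0n -[X in iota X _]addn0 iotaDl count_map.
rewrite (@eq_in_count _ _ (pred1 r)) => [|x]; last first.
  by rewrite mem_iota add0n /= modnMDl => xt; rewrite modn_small.
by rewrite count_uniq_mem ?iota_uniq // mem_iota rt addn1.
Qed.

Lemma phi_so_eq0 t n (phi : {rmorphism symfun -> symfun}) lam r :
  is_varphi t phi -> (size lam <= n * t)%N -> (r < t)%N ->
  (mres t lam (n * t) r + mres t lam (n * t) (t - r.+1))%N <> n.*2 ->
  phi (so lam) = 0.
Proof.
move=> phiP sN rt neq; have t0 : (0 < t)%N by lia.
rewrite (phi_so_entry _ sN); set N := (n * t)%N in neq *.
pose a := fun x => ((x %% t == r) || (x %% t == t - r.+1))%N.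
apply: (@det_unbalanced _ _ _ (fun i : 'I_N => a (nth 0%N (beta lam N) i)) (fun j : 'I_N => a j)).
  move=> i j; rewrite mxE => ab; apply: entry_other => //; apply/negP.
  move: ab; rewrite /a.
  have := ltn_pmod (nth 0%N (beta lam N) i) t0; have := ltn_pmod j t0.
  move: (_ %% t)%N (_ %% t)%N => u v; clear -rt; lia.
have -> : #|(fun i : 'I_N => a (nth 0%N (beta lam N) i))| = count a (beta lam N).
  rewrite -[in RHS](mkseq_nth 0%N (beta lam N)) size_map size_iota count_map.
  exact: (card_ord_count (fun i => a (nth 0%N (beta lam N) i))).
rewrite (card_ord_count a).
(* The middle residue is its own opposite and must be counted once: there [m_r] rows face [n]
   columns. *)
have cnt s : count a s = if r == (t - r.+1)%N then count (fun x => x %% t == r)%N s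
    else (count (fun x => x %% t == r) s + count (fun x => x %% t == (t - r.+1)) s)%N.
  case: eqP => rr; first by apply: eq_count => x; rewrite /a -rr orbb.
  rewrite -count_predUI [X in (_ + X)%N](@eq_count _ _ pred0) ?count_pred0 ?addn0.
    by apply: eq_count.
  by move=> x /=; apply/negP => /andP[/eqP -> /eqP].
rewrite !cnt !count_residue_iota //; last by lia.
rewrite -/(mres _ _ _ _) -/(mres _ _ _ _).
by case: (r =P (t - r.+1)%N) => rr; [rewrite -rr in neq|]; lia.
Qed.

(** The sum has [t./2] terms and ['C(t, 2)] has the parity of [t./2], so all the ['C(n.+1, 2)]
    cancel. What is left of the product with [n * t] is even for [t] even and gives [n * k] for [t]
    odd. *)
Lemma odd_eps_so t n (m : nat -> nat) k : (odd t -> odd k = odd (\sum_(uphalf t <= r < t) (m r + n))) ->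
  odd ('C(t, 2) * 'C(n.+1, 2)
       + \sum_(uphalf t <= r < t) ('C((m r).+1, 2) + 'C(n.+1, 2) + n * t * (m r + n)))
  = odd (\sum_(uphalf t <= r < t) 'C((m r).+1, 2) + (if odd t then n * k else 0)).
Proof.
move=> kP; set h := t./2; have tE : t = (h.*2 + odd t)%N by rewrite addnC odd_double_half.
have uE : uphalf t = (h + odd t)%N by rewrite uphalf_half addnC.
have bin2t : odd ('C(t, 2) + h) = false.
  clear kP uE; case ot: (odd t) in tE; move: h tE => h' tE.
    by rewrite bin2odd // tE addn1 /= doubleK oddD oddM /= odd_double addbb.
  rewrite bin2 tE addn0 -doubleMl doubleK oddD oddM.
  by case: h' {tE} => // h'; rewrite doubleS /= odd_double andbT addbb.
rewrite 2!big_split /= sum_nat_const_nat -big_distrr /= !(oddD, oddM).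
rewrite uE (_ : t - (h + odd t) = h)%N -?uE; last by lia.
move: bin2t; rewrite oddD; set S := odd (\sum_(_ <= _ < _) _).
have -> : odd (if odd t then n * k else 0)%N
    = odd t && odd n && odd (\sum_(uphalf t <= r < t) (m r + n)).
  by move: kP; case: (odd t) => [/(_ isT) <-|_] //=; rewrite oddM.
by odd_cases; case: (S).
Qed.

Theorem theorem3p4 (t n : nat) (phi : {rmorphism symfun -> symfun})
    (lam core : seq nat) :
  (2 <= t)%N ->
  is_varphi t phi ->
  is_partition lam ->
  (size lam <= n * t)%N ->
  is_tcore t lam core ->
  (conj_part core <> core -> phi (so lam) = 0) /\
  (conj_part core = core ->
   phi (so lam) =
     (-1) ^+ eps_so t n lam core * (-1) ^+ wperm t lam (n * t)
     * (\prod_(0 <= r < ((t - 2) %/ 2).+1)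
          rs (tquotient t lam (n * t) r) (tquotient t lam (n * t) (t - r - 1)))
     * (if odd t then so (tquotient t lam (n * t) ((t - 1) %/ 2)) else 1)).
Proof.
move=> t2 phiP pl sN [rem norib]; have t0 : (0 < t)%N by lia.
have [pc sc mc] := core_partition t0 pl sN rem.
set N := (n * t)%N; pose m := mres t lam N; split=> cc.
  have [all|] := boolP [forall r : 'I_t, m r + m (t - r.+1) == n.*2]%N.
    case: cc; apply: (core_self_conj t0 pc sc norib) => r rt; rewrite !mc.
    exact/eqP/(forallP all (Ordinal rt)).
  rewrite negb_forall => /existsP[r /eqP neq].
  exact: phi_so_eq0 phiP sN (ltn_ord r) neq.
have mm r : (r < t)%N -> (m r + m (t - r.+1) = n.*2)%N.
  by move=> rt; rewrite /m -!mc; apply: (self_conj_core t0 pc sc norib).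
pose c := blocks (cols t n m) 0 t.
have pcols : perm_eq c (iota 0 N) by apply: perm_cols => //; rewrite sum_mres.
pose P := blocks (bead_pairs t n m lam) 0 t.
have P1 : [seq x.1 | x <- P] = sort (residue_le t) (beta lam N).
  rewrite sort_residues // /P /blocks map_flatten -map_comp; congr flatten.
  by apply: eq_map => r /=; rewrite -map_comp.
have P2 : [seq x.2 | x <- P] = c.
  rewrite /P /c /blocks map_flatten -map_comp; congr flatten.
  by apply: eq_map => r /=; rewrite -map_comp.
have sP : size P = N by rewrite -(size_map (fun x => x.1)) P1 size_sort size_map size_iota.
pose E := entry t n phi.
(* Taking the rows in sorted order costs the sign of [wperm], taking the columns in the order [c]
   the sign of its inversions. *)
have detP : pair_det E P = (-1) ^+ inversions c * ((-1) ^+ wperm t lam N * phi (so lam)).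
  rewrite (phi_so_entry _ sN) -/N -det_perm -det_mulmx -row_permE.
  transitivity (\det (\matrix_(i < N, j < N) E (nth 0%N (map fst P) i) (nth 0%N (map snd P) j))).
    rewrite /pair_det sP; congr (\det _); apply/matrixP => i j.
    by rewrite !mxE !(nth_map (0, 0)%N) ?sP.
  rewrite P1 P2 (det_perm_cols (fun i => E (nth 0%N (sort (residue_le t) (beta lam N)) i)) pcols).
  congr (_ * \det _); apply/matrixP => i j; rewrite !mxE wpermP.
  by rewrite (nth_map i) ?size_enum_ord // nth_ord_enum.
have -> : phi (so lam) = (-1) ^+ inversions c * (-1) ^+ wperm t lam N * pair_det E P.
  by rewrite detP -mulrA [X in _ * X]mulrCA !signrMK.
have PE : P = blocks (bead_pairs t n m lam) (t./2 - t./2) (t./2.*2 + odd t).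
  by rewrite subnn addnC odd_double_half.
rewrite PE pair_det_blocks // subnn !mulrA.
have oi : odd (inversions c) = odd (eps_so t n lam core).
  rewrite (odd_inversions_cols t0 mm (sum_mres _ _ t0)); apply: odd_eps_so => ot.
  rewrite (odd_rk_core t0 pc sc norib ot) => [|r rt]; last by rewrite !mc; apply: mm.
  by congr odd; apply: eq_bigr => r _; rewrite mc.
have -> : (((t - 2) %/ 2).+1 = t./2)%N by rewrite divn2 subn2; case: (t) t2 => [|[|t']].
rewrite -(signr_odd _ (inversions c)) oi signr_odd; congr (_ * _ * _).
  by apply: eq_bigr => r _; rewrite -subnDA addn1.
by case ot: (odd t); rewrite // divn2 subn1 -[in t.-1](odd_double_half t) ot /= add0n doubleK.
Qed.
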